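(* Let $F$ be a (commutative) field, let $d\geq 3$ be an integer, let $V$ be the $d$-dimensional vector space over $F$, and let $L=\mathrm{Sub}(V)$ be the lattice of all subspaces of $V$. Let $k$ be a positive integer, let $t:=f^{\mathrm{mng}}(F)$, and let $$\mu:=\binom{d}{\lfloor d/2\rfloor}_{|F|}.$$ Then, with $L^k$ denoting the $k$-th direct power of $L$, all of the following hold: (i) $\Bigl\lceil \dfrac{t}{\lfloor d^2/4\rfloor}\Bigr\rceil\leq f^{\mathrm{mng}}(L)\leq f^{\mathrm{mng}}(L^k)$; (ii) if $k\leq\mu$, then $f^{\mathrm{mng}}(L^k)\leq 5+\Bigl\lceil \dfrac{t}{\lfloor d^2/4\rfloor}\Bigr\rceil$; (iii) if $t=0$, $d=3$, and $k\in\{1,2,3,4\}$, then $f^{\mathrm{mng}}(L^k)=4$; (iv) if $t=0$, $d=3$, and $5\leq k\leq\mu$ (with $k$ a positive integer), then $f^{\mathrm{mng}}(L^k)=5$.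
   Context: For a lattice or a field $A$, $f^{\mathrm{mng}}(A):=\min\{|X| : X \text{ is a generating set of } A\}$, a (finite or infinite) cardinal number. A lattice is generated by $X$ if no proper sublattice (subset closed under binary joins and meets) contains $X$; a field is generated by $X$ if no proper subfield contains $X$ (so $f^{\mathrm{mng}}(F)=0$ if and only if $F$ is a prime field). The subspace lattice is ordered by inclusion. For a cardinal $t$ and a positive integer $n$, $\lceil t/n\rceil:=\min\{m : m \text{ is a cardinal and } mn\geq t\}$. Gaussian binomial coefficients: for integers $0\leq r\leq m$, $m\geq 1$, and a prime power $q$, $$\binom{m}{r}_q:=\frac{(1-q^{m})(1-q^{m-1})\cdots(1-q^{m-r+1})}{(1-q)(1-q^{2})\cdots(1-q^{r})},$$ which is the number of $r$-dimensional subspaces of the $m$-dimensional vector space over the $q$-element field. For an infinite cardinal $\lambda$ and $1\leq r\leq m-1$, by convention $\binom{m}{r}_\lambda:=\lambda$. *)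

(* Defs.v *)
From HB Require Import structures.
From mathcomp Require Import all_boot all_order all_algebra.
From mathcomp Require Import boolp classical_sets functions cardinality.
From mathcomp Require Import ring.

Set Implicit Arguments.
Unset Strict Implicit.
Unset Printing Implicit Defensive.

Import Order.TTheory GRing.Theory Num.Theory.

(* Cardinal numbers are handled relationally, as in mathcomp's cardinality.v: *)
(* a type stands for its own cardinal, so that 'I_n stands for the natural    *)
(* number n, A + B and A * B stand for the sum and the product, and cardinals *)
(* are compared up to injections and bijections.                              *)
Notation "A <=c B" := (card_le (@setT A%type) (@setT B%type))
  (at level 70, no associativity) : type_scope.
Notation "A =c B" := (card_eq (@setT A%type) (@setT B%type))
  (at level 70, no associativity) : type_scope.

Local Open Scope classical_set_scope.

Definition is_cmin (P : Type -> Prop) (M : Type) : Prop :=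
  P M /\ forall N, P N -> (M <=c N)%type.

(* The least cardinal satisfying P; by cminP the default is irrelevant as     *)
(* soon as P is satisfiable.                                                  *)
Definition cmin (P : Type -> Prop) : Type :=
  if pselect (exists M, is_cmin P M) is left exM then sval (cid exM)
  else Empty_set.

Section CminP.

Lemma least_card_set (T : Type) (S : set (set T)) : S !=set0 ->
  exists2 A, S A & forall B, S B -> card_le A B.
Proof.
move=> [S0 SS0].
have [[t _]|noT] := pselect (exists t : T, True); last first.
  exists S0 => // B _; suff -> : S0 = set0 by exact: card_ge0.
  by apply/seteqP; split => // x _; apply: noT; exists x.
pose P (G : set (set T -> T)) := (forall f B, G f -> S B -> B (f B)) /\
  (forall f g B, G f -> G g -> S B -> f B = g B -> f = g).
have [|G [[GS Ginj] Gmax]] := @Zorn_bigcup (set T -> T) P.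
  move=> F FP Ftot; split=> [f B [X FX Xf] SB|f g B [X FX Xf] [Y FY Yg] SB e].
    by have [XS _] := FP _ FX; exact: (XS f B).
  have [XY|YX] := Ftot _ _ FX FY.
    by have [_ Yinj] := FP _ FY; apply: (Yinj _ _ B) => //; exact: XY.
  by have [_ Xinj] := FP _ FX; apply: (Xinj _ _ B) => //; exact: YX.
have [[A [SA AG]]|nex] :=
  pselect (exists A, S A /\ A `<=` [set f A | f in G]).
  exists A => // B SB; apply: card_le_trans (subset_card_le AG) _.
  apply: card_le_trans (card_image_le _ _) _.
  have : card_eq [set f B | f in G] G.
    by apply: inj_card_eq => f g /set_mem Gf /set_mem Gg; exact: Ginj.
  rewrite card_eq_le => /andP[_ /card_le_trans]; apply.
  by apply: subset_card_le => _ [f Gf <-]; exact: (GS f B).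
have miss B : exists x, S B -> B x /\ ~ [set f B | f in G] x.
  have [SB|nSB] := pselect (S B); last by exists t.
  apply: contrapT => nx; apply: nex; exists B; split=> // x Bx.
  by apply: contrapT => nGx; apply: nx; exists x.
pose g B := sval (cid (miss B)).
have gP B : S B -> B (g B) /\ ~ [set f B | f in G] (g B).
  by rewrite /g; case: cid.
have nGg : ~ G g by move=> Gg; have [_] := gP _ SS0; apply; exists g.
exfalso; apply: (Gmax (G `|` [set g])).
  rewrite properEneq; split; last by move=> ? ?; left.
  by apply/eqP => E; apply: nGg; rewrite E; right.
split=> [f B [Gf|->] SB|f h B [Gf|->] [Gh|->] SB e //].
- exact: (GS f B).
- by have [] := gP _ SB.
- exact: (Ginj _ _ B).
- by have [_ []] := gP _ SB; exists f.
- by have [_ []] := gP _ SB; exists h.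
Qed.

Lemma card_le_total (T U : Type) : (T <=c U)%type \/ (U <=c T)%type.
Proof.
have eT : card_eq (@inl T U @` setT) (@setT T).
  by apply: inj_card_eq => x y _ _ [].
have eU : card_eq (@inr T U @` setT) (@setT U).
  by apply: inj_card_eq => x y _ _ [].
pose S := [set @inl T U @` setT; @inr T U @` setT].
have [|A SA Amin] := @least_card_set _ S; first by eexists; left.
case: SA Amin => -> Amin; [left|right].
  by rewrite -(card_le_eql eT) -(card_le_eqr eU); apply: Amin; right.
by rewrite -(card_le_eql eU) -(card_le_eqr eT); apply: Amin; left.
Qed.

Lemma cminP (P : Type -> Prop) : (exists M, P M) -> is_cmin P (cmin P).
Proof.
move=> [T PT]; rewrite /cmin; case: pselect => [exM|[]]; first by case: cid.
pose S := [set A : set T | exists2 N, P N & card_eq (@setT N) A].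
have [|A [M PM MA] Amin] := @least_card_set T S.
  by exists setT, T => //; exact: card_eqxx.
exists M; split=> // N PN; rewrite (card_le_eql MA).
have [TN|/card_subP[B NB _]] := card_le_total T N.
  exact: card_le_trans (card_leT A) TN.
rewrite -(card_le_eqr NB); apply: Amin.
by exists N => //; exact: card_esym.
Qed.

End CminP.

Definition field_generates (F : fieldType) (X : set F) : Prop :=
  forall K : {pred F}, divring_closed K -> (forall x, X x -> x \in K) ->
  forall x, x \in K.

Definition lattice_generates d (L : latticeType d) (X : set L) : Prop :=
  forall S : set L,
    (forall x y, S x -> S y -> S (Order.join x y) /\ S (Order.meet x y)) ->
    X `<=` S -> S = setT.

Definition mng_field (F : fieldType) : Type :=
  cmin (fun M => exists2 X : set F, field_generates X & card_eq (@setT M) X).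

Definition mng_lattice d (L : latticeType d) : Type :=
  cmin (fun M => exists2 X : set L, lattice_generates X & card_eq (@setT M) X).

Lemma mng_fieldP (F : fieldType) :
  (exists2 X : set F, field_generates X & card_eq (@setT (mng_field F)) X) /\
  forall X : set F, field_generates X -> card_le (@setT (mng_field F)) X.
Proof.
have [|exX minX] := @cminP (fun M => exists2 X : set F, field_generates X &
    card_eq (@setT M) X).
  by exists F, setT; [move=> K _ XK x; exact: XK | exact: card_eqxx].
split=> // X genX; rewrite -(card_le_eqr (card_setT X)).
by apply: minX; exists X => //; exact: card_setT.
Qed.

Lemma mng_latticeP d (L : latticeType d) :
  (exists2 X : set L, lattice_generates X &
     card_eq (@setT (mng_lattice L)) X) /\
  forall X : set L, lattice_generates X -> card_le (@setT (mng_lattice L)) X.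
Proof.
have [|exX minX] := @cminP (fun M => exists2 X : set L, lattice_generates X &
    card_eq (@setT M) X).
  exists L, setT; last exact: card_eqxx.
  by move=> K _ XK; apply/seteqP; split.
split=> // X genX; rewrite -(card_le_eqr (card_setT X)).
by apply: minX; exists X => //; exact: card_setT.
Qed.

Definition cceil_div (T : Type) (n : nat) : Type :=
  cmin (fun M => (T <=c M * 'I_n)%type).

Lemma cceil_divP (T : Type) (n : nat) : (0 < n)%N ->
  is_cmin (fun M => (T <=c M * 'I_n)%type) (cceil_div T n).
Proof.
case: n => // n _; apply: cminP; exists T.
have /inj_card_eq : {in (@setT T) &, injective (fun x => (x, @ord0 n))}.
  by move=> x y _ _ [].
by rewrite card_eq_le => /andP[_ /card_le_trans]; apply; exact: card_leT.
Qed.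

Fact vspace_display : Order.disp_t. Proof. exact: Order.Disp tt tt. Qed.

Section VspaceLattice.
Local Open Scope vspace_scope.
Variables (F : fieldType) (V : vectType F).
Implicit Types U W Z : {vspace V}.

Let subv_anti : antisymmetric (@subsetv F V).
Proof. by move=> U W /subv_anti. Qed.

Let subv_trans : transitive (@subsetv F V).
Proof. by move=> U W Z; exact: subv_trans. Qed.

HB.instance Definition _ := Order.Le_isPOrder.Build vspace_display {vspace V}
  (@subvv F V) subv_anti subv_trans.

HB.instance Definition _ :=
  Order.POrder_isMeetSemilattice.Build vspace_display {vspace V}
    (@subv_cap F V).

HB.instance Definition _ :=
  Order.POrder_isJoinSemilattice.Build vspace_display {vspace V}
    (@subv_add F V).

Lemma vspace_leE U W : (U <= W)%O = (U <= W). Proof. by []. Qed.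
Lemma vspace_meetE U W : Order.meet U W = U :&: W. Proof. by []. Qed.
Lemma vspace_joinE U W : Order.join U W = U + W. Proof. by []. Qed.

End VspaceLattice.

Section GaussBinomial.
Local Open Scope ring_scope.

(* The division is exact, see gauss_binomialE.                                *)
Definition gauss_binomial (m r q : nat) : nat :=
  absz (((\prod_(i < r) (1 - q%:Z ^+ (m - i))) %/
         (\prod_(i < r) (1 - q%:Z ^+ i.+1)))%Z).

Lemma gauss_binomial_ex (q m r : nat) : exists g : nat,
  forall R : comNzRingType, \prod_(i < r) (1 - q%:R ^+ (m - i)) =
    g%:R * \prod_(i < r) (1 - q%:R ^+ i.+1) :> R.
Proof.
elim: m r => [|m IHm] [|r]; try by exists 1%N => R; rewrite !big_ord0 mulr1.
  by exists 0%N => R; rewrite big_ord_recl subrr !mul0r.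
have [g Eg] := IHm r; have [h Eh] := IHm r.+1.
exists (g + q ^ r.+1 * h)%N => R.
have {Eg}EN := Eg R; have {Eh} := Eh R.
set D' := \prod_(i < r.+1) (1 - q%:R ^+ i.+1).
rewrite big_ord_recr /= => EN'.
have ED : D' = \prod_(i < r) (1 - q%:R ^+ i.+1) * (1 - q%:R ^+ r.+1).
  by rewrite /D' big_ord_recr.
rewrite big_ord_recl subn0; under eq_bigr do rewrite /= /bump add1n subSS.
rewrite natrD natrM natrX [RHS]mulrDl -[X in _ = _ + X]mulrA -EN' ED.
rewrite [X in _ = X + _]mulrA -EN.
set N := \prod_(i < r) (1 - _ ^+ (m - _)).
have [rm|mr] := leqP r m; last first.
  have -> : N = 0 by rewrite /N (bigD1 (Ordinal mr)) //= subnn subrr mul0r.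
  by rewrite !(mulr0, mul0r) addr0.
have -> : q%:R ^+ m.+1 = q%:R ^+ r.+1 * q%:R ^+ (m - r) :> R.
  by rewrite -exprD addSn subnKC.
by ring.
Qed.

Lemma gauss_binomialE (m r q : nat) : (1 < q)%N ->
  (gauss_binomial m r q)%:R =
    (\prod_(i < r) (1 - q%:R ^+ (m - i))) /
    (\prod_(i < r) (1 - q%:R ^+ i.+1)) :> rat.
Proof.
move=> q1; have [g Eg] := gauss_binomial_ex q m r.
have den0 (R : numDomainType) : \prod_(i < r) (1 - q%:R ^+ i.+1) != 0 :> R.
  apply/prodf_neq0 => i _; rewrite subr_eq0 eq_sym -natrX pnatr_eq1.
  by rewrite -(expn0 q) eqn_exp2l.
have -> : gauss_binomial m r q = g.
  have := den0 int; rewrite /gauss_binomial; have := Eg int.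
  by rewrite !natz => -> /mulzK ->.
by rewrite Eg mulfK ?den0.
Qed.

(* If A has finite cardinality q the value is the number [m r]_q; otherwise   *)
(* it is the cardinal of A, which is the convention for 1 <= r <= m - 1, the  *)
(* only range in which it is used.                                            *)
Definition cgauss_binomial (m r : nat) (A : Type) : Type :=
  if pselect (finite_set (@setT A)) is left finA then
    'I_(gauss_binomial m r (sval (cid finA)))
  else A.

Lemma cgauss_binomial_fin (m r q : nat) (A : Type) :
  card_eq (@setT A) `I_q -> cgauss_binomial m r A = 'I_(gauss_binomial m r q).
Proof.
move=> Aq; rewrite /cgauss_binomial; case: pselect => [finA|[]]; last first.
  by exists q.
case: cid => n /= An; suff -> : n = q by [].
by apply/card_eq_II; rewrite -(card_eql An).
Qed.

Lemma cgauss_binomial_inf (m r : nat) (A : Type) :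
  infinite_set (@setT A) -> cgauss_binomial m r A = A.
Proof. by rewrite /cgauss_binomial; case: pselect. Qed.

End GaussBinomial.

(* Main.v *)
Require Import Defs.
From HB Require Import structures.
From mathcomp Require Import all_boot all_order all_algebra.
From mathcomp Require Import boolp classical_sets functions cardinality.
From mathcomp Require Import ring zify.

Set Implicit Arguments.
Unset Strict Implicit.
Unset Printing Implicit Defensive.

Import Order.TTheory GRing.Theory Num.Theory.
Local Open Scope classical_set_scope.
Local Open Scope ring_scope.

(* Lower bound of (i): a subspace of dimension r has a basis matrix with an   *)
(* r x r identity minor, so it is rational over any subfield containing its   *)
(* r (d - r) <= d ^ 2 / 4 other entries, and the subspaces rational over a    *)
(* given subfield form a sublattice.                                          *)
(*   Upper bound of (ii): on a basis y_0, ..., y_(d-1), the four subspaces    *)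
(* spanned by the y_i with i even, the y_i with i odd, the y_i - y_(i+1) with *)
(* i even, and the y_i - y_(i+1) with i odd generate all the lines <y_i> and  *)
(* <y_i - y_j>; von Neumann's arithmetic then shows that the a such that all  *)
(* the <y_i - a y_j> are generated form a subfield K. A graph of a linear map *)
(* from the span of y_0, ..., y_(r-1) to that of the other y_i, r = d / 2,    *)
(* puts the d ^ 2 / 4 entries of its matrix into K. In the power L^k these    *)
(* generators are taken constant, and one more generator, with pairwise       *)
(* incomparable components, separates the coordinates.                        *)
(*   For (iii) and (iv), a linear map that sends the i-th components of the   *)
(* generators into their j-th components does so for the components of every  *)
(* element of L^k: it is zero if i != j and a homothety if i = j. When d = 3, *)
(* counting dimensions then forces at least 4 generators, and if there are    *)
(* exactly 4, the sets of generators whose i-th component is a plane are      *)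
(* pairwise distinct subsets of {0, 1, 2, 3} of a common size other than 2,   *)
(* so that k <= 4. Conversely, for k <= 4 one lets the i-th generator have a  *)
(* plane as its i-th component, and points elsewhere.                         *)

(** * Cardinals *)

(** For (i), rationality over a subfield passes to joins and meets ([rational_sublattice]), and each
    subspace is described by at most d^2/4 scalars ([rational_entries_ex]); hence the scalars
    attached to a generating set of L generate F ([mng_field_le_mul]). Projection to one coordinate
    compares L with L^k. For (ii), the 5 consists of four constant tuples, from which
    [sublattice_bas] and [sublattice_succ] extract a frame, and one tuple of pairwise incomparable
    subspaces, which exists for k <= mu by [subspace_antichain_ex]. Adding the graphs,
    [quadruple_graphs_full] yields all constant tuples, and [sublattice_diag_full] separates the
    coordinates. For (iii) and (iv), [generators_endo_cost] and [generators_hom_cost] compare the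
    number of linear equations that the generators impose on an endomorphism with the dimension 9 of
    End(V). This gives the lower bounds [generators_ge4] and [four_generators_le4];
    [four_generators] attains 4, and (ii) attains 5. *)

Section Cardinals.
Variables T U : Type.

Lemma card_le_injP : (T <=c U)%type <-> exists f : T -> U, injective f.
Proof.
split=> [/card_leP[f]|[f finj]].
  exists (fun x => set_val (f (to_setT x))) => x y E.
  have /(@inj _ _ _ f) : f (to_setT x) = f (to_setT y) by exact: val_inj.
  by rewrite !in_setT => /(_ isT isT) /(congr1 set_val).
have /inj_card_eq : {in (@setT T) &, injective f} by move=> x y _ _ /finj.
rewrite card_eq_le => /andP[_ /card_le_trans]; apply; exact: card_leT.
Qed.

Lemma card_eq_range (X : set U) : card_eq (@setT T) X ->
  exists2 f : T -> U, injective f & range f = X.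
Proof.
move=> /card_eqP[f]; exists (fun x => set_val (f (to_setT x))).
  move=> x y E; have /(@inj _ _ _ f) : f (to_setT x) = f (to_setT y) by exact: val_inj.
  by rewrite !in_setT => /(_ isT isT) /(congr1 set_val).
apply/seteqP; split=> [_ [x _ <-]|x Xx]; first exact: set_valP.
have [y _ E] := @surj _ _ _ _ f (SigSub (mem_set Xx)) I.
by exists (set_val y) => //; rewrite (_ : to_setT _ = y) ?E //; apply: val_inj.
Qed.

Lemma card_range_le (f : T -> U) : card_le (range f) (@setT T).
Proof. exact: card_image_le. Qed.

End Cardinals.

Lemma card_eqc_le (T U : Type) : (T =c U)%type -> (T <=c U)%type.
Proof. by rewrite card_eq_le => /andP[]. Qed.

Lemma card_eqc_sym (T U : Type) : (T =c U)%type -> (U =c T)%type.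
Proof. exact: card_esym. Qed.

Lemma card_le_anti (T U : Type) : (T <=c U)%type -> (U <=c T)%type -> (T =c U)%type.
Proof. by move=> TU UT; rewrite card_eq_le TU. Qed.

Lemma field_generatesW (F : fieldType) (X Y : set F) :
  X `<=` Y -> field_generates X -> field_generates Y.
Proof. by move=> XY gX K Kc YK; apply: gX => // x /XY; apply: YK. Qed.

(** * Coordinates and generation of the subspace lattice *)

Section Lines.
Variables (F : fieldType) (V : vectType F).

Lemma vlineZ (a : F) (v : V) : a != 0 -> <[a *: v]>%VS = <[v]>%VS.
Proof.
move=> a0; apply/eqP; rewrite eqEsubv -!memvE memvZ ?memv_line //=.
by rewrite -{1}(scalerK a0 v) memvZ ?memv_line.
Qed.

Lemma vlineN (v : V) : <[- v]>%VS = <[v]>%VS.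
Proof. by rewrite -scaleN1r vlineZ // oppr_eq0 oner_eq0. Qed.

End Lines.

Section Coordinates.
Variables (F : fieldType) (V : vectType F).
Implicit Types (u v w : V) (i j l : nat) (U W : {vspace V}) (I : nat -> bool).

Local Notation d := (\dim (fullv : {vspace V})).

Definition basv i : V := (vbasis fullv)`_i.

(* Junk value: 0 for d <= i, which spares the case analysis on i.+1 < d.      *)
Definition coordv i v : F :=
  if insub i is Some o then coord (vbasis fullv) o v else 0.

Lemma coordv_is_linear i : linear_for *%R (coordv i).
Proof.
by move=> a u v; rewrite /coordv; case: insub => [o|];
  rewrite ?mulr0 ?addr0 // linearP.
Qed.

HB.instance Definition _ i :=
  GRing.isLinear.Build F V F *%R (coordv i) (coordv_is_linear i).

Lemma coordvE i v (id_ : (i < d)%N) :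
  coordv i v = coord (vbasis fullv) (Ordinal id_) v.
Proof. by rewrite /coordv insubT. Qed.

Lemma coordv_out i v : (d <= i)%N -> coordv i v = 0.
Proof. by move=> di; rewrite /coordv insubF // ltnNge di. Qed.

Lemma coordv_bas i j : (j < d)%N -> coordv i (basv j) = (i == j)%:R.
Proof.
move=> jd; have fr := basis_free (vbasisP (fullv : {vspace V})).
have [id_|di] := ltnP i d.
  by rewrite (coordvE _ id_) /basv (coord_free (Ordinal jd) (Ordinal id_) fr) eq_sym.
by rewrite coordv_out // gtn_eqF // (leq_trans jd).
Qed.

Lemma coordv_inj u v : (forall i, coordv i u = coordv i v) -> u = v.
Proof.
move=> E; rewrite (coord_vbasis (memvf u)) (coord_vbasis (memvf v)).
apply: eq_bigr => o _; have := E o; rewrite !(coordvE _ (ltn_ord o)).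
by rewrite (_ : Ordinal _ = o) => [->|] //; apply: val_inj.
Qed.

Definition vec (f : nat -> F) : V := \sum_(i < d) f i *: basv i.

Lemma coordv_vec i f : coordv i (vec f) = if (i < d)%N then f i else 0.
Proof.
case: ltnP => [id_|di]; last by rewrite coordv_out.
rewrite /vec linear_sum /= (bigD1 (Ordinal id_)) //= linearZ /= coordv_bas //.
rewrite eqxx mulr1 big1 ?addr0 // => o no; rewrite linearZ /= coordv_bas //.
by rewrite (_ : (i == o) = false) ?mulr0 //; apply: contraNF no => /eqP io;
  apply/eqP/val_inj.
Qed.

Definition subspaceP (P : V -> Prop) :=
  P 0 /\ forall (a : F) u v, P u -> P v -> P (a *: u + v).

(** A subspace of maximal dimension inside P absorbs every v with P v, since adding the line of v
    stays inside P. *)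
Lemma subspace_ex (P : V -> Prop) : subspaceP P ->
  exists U : {vspace V}, forall v, v \in U <-> P v.
Proof.
move=> [P0 PZD].
pose Q n := `[< exists U, (forall v, v \in U -> P v) /\ \dim U = n >].
have exQ : exists n, Q n.
  exists 0%N; apply/asboolP; exists 0%VS; rewrite dimv0; split=> // v.
  by rewrite memv0 => /eqP->.
have Qd n : Q n -> (n <= d)%N.
  by case/asboolP=> U [_ <-]; rewrite dimvS ?subvf.
case: (ex_maxnP exQ Qd) => n /asboolP[U [UP dU]] nmax.
exists U => v; split; first exact: UP.
move=> Pv; suff /eqP -> : (U == U + <[v]>)%VS.
  by rewrite memvE addvSr.
rewrite eqEdim addvSl dU nmax //; apply/asboolP; exists (U + <[v]>)%VS.
split=> // _ /memv_addP[x xU [_ /vlineP[a ->] ->]].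
by rewrite addrC; apply: PZD => //; apply: UP.
Qed.

Definition vset (P : V -> Prop) : {vspace V} :=
  xget 0%VS [set U : {vspace V} | forall v, v \in U <-> P v].

Lemma mem_vset P v : subspaceP P -> v \in vset P <-> P v.
Proof. by move=> /subspace_ex[U UP]; rewrite /vset; case: xgetP => [W _|/(_ U)]. Qed.

Definition csupp (I : nat -> bool) v := forall j, ~~ I j -> coordv j v = 0.

Definition coordsp I : {vspace V} :=
  (\sum_(i < d | I i) <[basv i]>)%VS.

Lemma mem_coordsp I v : v \in coordsp I <-> csupp I v.
Proof.
split=> [/memv_sumP[f fI ->] j nIj|sv].
  rewrite linear_sum big1 //= => o Io; have /vlineP[a ->] := fI _ Io.
  rewrite linearZ /= coordv_bas // (_ : (j == o) = false) ?mulr0 //.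
  by apply: contraNF nIj => /eqP->.
suff -> : v = \sum_(i < d | I i) coordv i v *: basv i.
  by apply: memv_sumr => o _; rewrite memvZ ?memv_line.
apply: coordv_inj => j; rewrite linear_sum /=.
have [jd|dj] := ltnP j d; last first.
  by rewrite coordv_out // big1 // => o _; rewrite coordv_out.
have E o : I (val o) -> o != Ordinal jd ->
    coordv j (coordv (val o) v *: (basv (val o) : V)) = 0.
  move=> _ no; rewrite linearZ /= coordv_bas // (_ : (j == o) = false) ?mulr0 //.
  by apply: contraNF no => /eqP jo; apply/eqP/val_inj.
case Ij : (I j); last by rewrite sv ?Ij // big1 // => o Io; rewrite E //;
  apply: contraTneq Io => ->; rewrite /= Ij.
rewrite (bigD1 (Ordinal jd)) //= linearZ /= coordv_bas // eqxx mulr1 big1 ?addr0 //.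
by move=> o /andP[]; exact: E.
Qed.

Lemma bas_coordsp I i : (i < d)%N -> I i -> basv i \in coordsp I.
Proof.
move=> id_ Ii; apply/mem_coordsp => j; rewrite coordv_bas //.
by case: eqP => // ->; rewrite Ii.
Qed.

Lemma eq_coordsp I I' : {in gtn d, I =1 I'} -> coordsp I = coordsp I'.
Proof. by move=> E; apply: eq_bigl => i; apply: E; rewrite inE /=. Qed.

End Coordinates.

Arguments basv {F V} i.
Arguments coordv {F V} i v.
Arguments vec {F V} f.
Arguments csupp {F V} I v.
Arguments coordsp {F V} I.

(** * Von Neumann's arithmetic of lines over a frame *)

Section Sublattice.
Variables (F : fieldType) (V : vectType F).
Implicit Types (u v w : V) (i j l : nat) (U W E : {vspace V}).
Implicit Types (I : nat -> bool) (a b : F).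

Local Notation d := (\dim (fullv : {vspace V})).

Variable S : set {vspace V}.
Hypothesis Slat : forall U W, S U -> S W -> S (U + W)%VS /\ S (U :&: W)%VS.

Let SD U W : S U -> S W -> S (U + W)%VS.
Proof. by move=> SU SW; have [] := Slat SU SW. Qed.

Let SI U W : S U -> S W -> S (U :&: W)%VS.
Proof. by move=> SU SW; have [] := Slat SU SW. Qed.

(** The line is the meet of [<[u]> + W] with E: two vectors of E with the same part along u differ
    by an element of both W and E, hence by 0. All the coefficient arithmetic below rests on this
    identity. *)
Lemma sublattice_elim u w E W : S E -> S W -> S <[u]>%VS -> w \in W ->
  u + w \in E -> (forall x, x \in W -> x \in E -> x = 0) -> S <[u + w]>%VS.
Proof.
move=> SE SW Su wW uwE WE0.
suff -> : <[u + w]>%VS = ((<[u]> + W) :&: E)%VS by apply: SI => //; apply: SD.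
apply/vspaceP => x; rewrite memv_cap; apply/idP/idP.
  move=> /vlineP[a ->]; rewrite (rpredZ _ uwE) andbT scalerDr.
  by rewrite memv_add ?memvZ ?memv_line.
case/andP=> /memv_addP[_ /vlineP[a ->] [w' w'W ->]] xE.
suff -> : w' = a *: w by rewrite -scalerDr memvZ ?memv_line.
apply/eqP; rewrite -subr_eq0; apply/eqP; apply: WE0.
  by rewrite rpredB // memvZ.
rewrite (_ : _ - _ = (a *: u + w') - a *: (u + w)).
  by rewrite rpredB // memvZ.
by rewrite scalerDr opprD addrACA subrr add0r.
Qed.

Lemma sublattice_elim1 u w E : S E -> S <[u]>%VS -> S <[w]>%VS ->
  u + w \in E -> w \notin E -> S <[u + w]>%VS.
Proof.
move=> SE Su Sw uwE wE; apply: (@sublattice_elim _ _ E <[w]>%VS) => //.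
  exact: memv_line.
move=> _ /vlineP[a ->] awE; have [->|a0] := eqVneq a 0; first by rewrite scale0r.
by move: wE; rewrite -(scalerK a0 w) memvZ.
Qed.

Section Frame.
Hypothesis d3 : (3 <= d)%N.
Hypothesis Sbas : forall i, (i < d)%N -> S <[basv i]>%VS.

Lemma sublattice0 : S 0%VS.
Proof.
have /SI/(_ (@Sbas 1 _)) := @Sbas 0 (leq_trans (isT : 0 < 3)%N d3).
move=> /(_ (leq_trans (isT : 1 < 3)%N d3)); congr S; apply/eqP.
rewrite -subv0; apply/subvP=> v /memv_capP[/vlineP[a ->] /vlineP[b E]].
have /eqP := congr1 (coordv 0%N) E; rewrite !linearZ /= !coordv_bas ?(leq_trans _ d3) //.
by rewrite mulr1 mulr0 => /eqP->; rewrite scale0r mem0v.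
Qed.

Lemma sublattice_sum (T : finType) (P : pred T) (U : T -> {vspace V}) :
  (forall x, P x -> S (U x)) -> S (\sum_(x | P x) U x)%VS.
Proof. by move=> SU; elim/big_ind: _ => //; apply: sublattice0. Qed.

Lemma sublattice_coordsp I : S (coordsp I).
Proof. by apply: sublattice_sum => i _; apply: Sbas. Qed.

(** Von Neumann's encoding of the scalar a by a line of the plane spanned by y_i and y_j. *)
Definition scoef i j a := S <[basv i - a *: basv j]>%VS.

Hypothesis Sdiff : forall i j, (i < d)%N -> (j < d)%N -> i != j -> scoef i j 1.

(** y_i - ab y_l = (y_i - a y_j) + a (y_j - b y_l), cut out by the span of y_i and y_l. *)
Lemma scoefM i j l a b : (i < d)%N -> (j < d)%N -> (l < d)%N ->
  i != j -> j != l -> i != l -> scoef i j a -> scoef j l b -> scoef i l (a * b).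
Proof.
move=> id_ jd ld ij jl il Sa Sb; rewrite /scoef.
have [->|a0] := eqVneq a 0; first by rewrite mul0r scale0r subr0; apply: Sbas.
have Sab : S <[a *: (basv j - b *: basv l)]>%VS.
  by rewrite vlineZ.
have := @sublattice_elim1 (basv i - a *: basv j) _
  (coordsp (pred2 i l)) (sublattice_coordsp _) Sa Sab.
rewrite scalerBr scalerA addrA subrK; apply.
  by rewrite rpredB ?memvZ // bas_coordsp //= eqxx ?orbT.
apply/negP => /mem_coordsp/(_ j); rewrite /= negb_or eq_sym ij jl => /(_ isT).
rewrite linearB !linearZ /= !coordv_bas // eqxx (negbTE jl) mulr0 subr0 mulr1.
by move/eqP; rewrite (negbTE a0).
Qed.

Lemma third_index_ex i j : exists2 l, (l < d)%N & (i != l) && (j != l).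
Proof.
have T l : (l < 3)%N -> (l < d)%N by move=> /leq_trans; apply.
case: i j => [|[|i]] [|[|j]];
  by [exists 0%N; rewrite ?T | exists 1%N; rewrite ?T | exists 2%N; rewrite ?T].
Qed.

Lemma scoef_r i j l a : (i < d)%N -> (j < d)%N -> (l < d)%N ->
  i != j -> i != l -> scoef i j a -> scoef i l a.
Proof.
move=> id_ jd ld ij il Sa; have [<-//|jl] := eqVneq j l.
by rewrite -[a]mulr1; apply: (scoefM id_ jd) => //; apply: Sdiff.
Qed.

Lemma scoef_l i j l a : (i < d)%N -> (j < d)%N -> (l < d)%N ->
  i != j -> l != j -> scoef i j a -> scoef l j a.
Proof.
move=> id_ jd ld ij lj Sa; have [<-//|il] := eqVneq i l.
have li : l != i by rewrite eq_sym.
by rewrite -[a]mul1r; apply: (scoefM ld id_) => //; apply: Sdiff.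
Qed.

(** One index is exchanged at a time, multiplying by the coefficient 1. When the wanted pair is the
    given one reversed, the route passes through a third index, available as d >= 3. *)
Lemma scoef_any i j l m a : (i < d)%N -> (j < d)%N -> (l < d)%N -> (m < d)%N ->
  i != j -> l != m -> scoef i j a -> scoef l m a.
Proof.
move=> id_ jd ld md ij lm Sa; have [il|il] := eqVneq i m; last first.
  by apply: (scoef_l id_) => //; apply: (scoef_r id_ jd).
move: Sa; rewrite il in ij id_ * => Sa; have [lj|lj] := eqVneq l j; last first.
  by apply: (@scoef_r l j) => //; apply: (@scoef_l m).
rewrite -lj in ij Sa *; have [n nd /andP[mn ln]] := third_index_ex m l.
apply: (@scoef_r l n) => //; apply: (@scoef_l m) => //.
exact: (@scoef_r m l).
Qed.

(** This line in three variables serves both negation and addition: adding - y_i leaves -(y_l + a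
    y_j), which encodes - a, and adding y_l - b y_j leaves y_i - (a + b) y_j. *)
Lemma scoef3 i j l a : (i < d)%N -> (j < d)%N -> (l < d)%N ->
  i != j -> j != l -> i != l -> scoef i j a ->
  S <[basv i - a *: basv j - basv l]>%VS.
Proof.
move=> id_ jd ld ij jl il Sa.
have Sl : S <[- basv l : V]>%VS by rewrite vlineN; apply: Sbas.
have SE : S (<[basv i - 1 *: basv l]> + <[basv j]>)%VS.
  by apply: SD; [apply: Sdiff|apply: Sbas].
apply: (sublattice_elim1 SE) => //.
  rewrite addrAC -[X in _ - X + _]scale1r memv_add ?memv_line //.
  by rewrite rpredN memvZ ?memv_line.
apply/negP => /memv_addP[_ /vlineP[x ->] [_ /vlineP[y ->] E]].
have := congr1 (coordv i) E; have := congr1 (coordv l) E.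
rewrite !(linearD, linearN, linearZ) /= ?(linearD, linearN, linearZ) /= !coordv_bas //.
rewrite !eqxx (negbTE ij) (negbTE il) ![l == _]eq_sym (negbTE il) (negbTE jl).
rewrite !(mulr0, mulr1, addr0, oppr0, subr0, sub0r, add0r) => + x0.
by rewrite -x0 mul0r => /eqP; rewrite oppr_eq0 oner_eq0.
Qed.

Lemma scoefN i j a : (i < d)%N -> (j < d)%N -> i != j ->
  scoef i j a -> scoef i j (- a).
Proof.
move=> id_ jd ij Sa; have [l ld /andP[il jl]] := third_index_ex i j.
apply: (@scoef_any l j) => //; rewrite ?[l == _]eq_sym //.
have Si : S <[- basv i : V]>%VS by rewrite vlineN; apply: Sbas.
have := @sublattice_elim1 _ _ (coordsp (pred2 l j)) (sublattice_coordsp _)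
  (scoef3 id_ jd ld ij jl il Sa) Si.
rewrite (_ : _ + - basv i = - (basv l + a *: basv j)); last first.
  by rewrite -addrA -addrA addrC addrA subrK opprD addrC.
rewrite rpredN rpredD ?memvZ ?bas_coordsp //= ?eqxx ?orbT //.
rewrite /scoef scaleNr opprK vlineN => /(_ isT); apply.
apply/negP => /mem_coordsp/(_ i); rewrite /= negb_or il ij => /(_ isT).
by rewrite linearN /= coordv_bas // eqxx => /eqP; rewrite oppr_eq0 oner_eq0.
Qed.

Lemma scoefD i j a b : (i < d)%N -> (j < d)%N -> i != j ->
  scoef i j a -> scoef i j b -> scoef i j (a + b).
Proof.
move=> id_ jd ij Sa Sb; have [l ld /andP[il jl]] := third_index_ex i j.
have Slb : S <[basv l - b *: basv j]>%VS.
  by apply: (@scoef_any i j) => //; rewrite eq_sym.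
have := @sublattice_elim1 _ _ (coordsp (pred2 i j)) (sublattice_coordsp _)
  (scoef3 id_ jd ld ij jl il Sa) Slb.
rewrite addrA subrK -addrA -opprD -scalerDl; apply.
  by rewrite rpredB ?memvZ // bas_coordsp //= eqxx ?orbT.
apply/negP => /mem_coordsp/(_ l); rewrite /= negb_or ![l == _]eq_sym il jl.
move=> /(_ isT); rewrite linearB !linearZ /= !coordv_bas // eqxx.
rewrite [l == _]eq_sym (negbTE jl) mulr0 subr0.
by move/eqP; rewrite oner_eq0.
Qed.

Lemma scoefV i j a : (i < d)%N -> (j < d)%N -> i != j ->
  scoef i j a -> scoef i j a^-1.
Proof.
move=> id_ jd ij Sa; have [->|a0] := eqVneq a 0.
  by rewrite /scoef invr0 scale0r subr0; apply: Sbas.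
apply: (@scoef_any j i) => //; first by rewrite eq_sym.
have na0 : - a != 0 by rewrite oppr_eq0.
rewrite /scoef -(vlineZ _ na0) scalerBr scalerA mulNr divff // scaleN1r opprK.
by rewrite scaleNr addrC.
Qed.

Definition coef_pred : {pred F} := [pred a | `[< scoef 0 1 a >]].

Let d0 : (0 < d)%N. Proof. exact: leq_trans d3. Qed.
Let d1 : (1 < d)%N. Proof. exact: leq_trans d3. Qed.

Lemma coef_predP i j a : (i < d)%N -> (j < d)%N -> i != j ->
  reflect (scoef i j a) (a \in coef_pred).
Proof.
by move=> id_ jd ij; apply: (iffP (asboolP _)); apply: scoef_any.
Qed.

Lemma coef_pred_divring : divring_closed coef_pred.
Proof.
split=> [|a b|a b].
- by apply/(coef_predP _ d0 d1) => //; apply: Sdiff.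
- move=> /(coef_predP _ d0 d1 isT) Sa /(coef_predP _ d0 d1 isT) Sb.
  by apply/(coef_predP _ d0 d1 isT)/scoefD => //; apply: scoefN.
- move=> /(coef_predP _ d0 d1 isT) Sa /(coef_predP _ d0 d1 isT) /(scoefV d0 d1 isT) Sb.
  have [l ld /andP[il jl]] := third_index_ex 0 1.
  apply/(coef_predP _ d0 ld il)/(scoefM d0 d1) => //.
  exact: (scoef_any d0 d1).
Qed.

Hypothesis coefT : forall a, a \in coef_pred.

(** After scaling a nonzero coordinate i to 1, the other coordinates are added one by one. *)
Lemma sublattice_vline v : S <[v]>%VS.
Proof.
suff H (s : seq nat) (f : nat -> F) i : (i < d)%N -> uniq (i :: s) ->
    {subset s <= gtn d} -> S <[basv i - \sum_(j <- s) f j *: basv j]>%VS.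
  have [->|v0] := eqVneq v 0; first exact: sublattice0.
  have [i id_ vi] : exists2 i, (i < d)%N & coordv i v != 0.
    apply: contrapT => H'; case/eqP: v0; apply: coordv_inj => i.
    rewrite linear0; have [di|di] := ltnP i d; last exact: coordv_out.
    by have [//|vi] := eqVneq (coordv i v) 0; case: H'; exists i.
  have := H (rem i (iota 0 d)) (fun j => - ((coordv i v)^-1 * coordv j v)) i id_.
  have ui := iota_uniq 0 d; have ii : i \in iota 0 d by rewrite mem_iota.
  rewrite -(perm_uniq (perm_to_rem ii)) ui => /(_ isT).
  have -> : basv i - \sum_(j <- rem i (iota 0 d))
      - ((coordv i v)^-1 * coordv j v) *: basv j = (coordv i v)^-1 *: v.
    under eq_bigr => j _ do rewrite scaleNr.
    rewrite sumrN opprK.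
    transitivity (\sum_(j <- iota 0 d) ((coordv i v)^-1 * coordv j v) *: (basv j : V)).
      by rewrite (perm_big _ (perm_to_rem ii)) big_cons mulVf // scale1r.
    have -> : iota 0 d = index_iota 0 d by rewrite /index_iota subn0.
    rewrite big_mkord.
    apply: coordv_inj => j.
    rewrite -/(vec (fun l => (coordv i v)^-1 * coordv l v)) coordv_vec linearZ /=.
    by case: ltnP => // dj; rewrite [coordv j v]coordv_out ?mulr0.
  by rewrite vlineZ ?invr_eq0 //; apply=> j /mem_rem; rewrite mem_iota.
elim: s => [|j s IHs] id_; first by rewrite big_nil subr0 => _ _; apply: Sbas.
rewrite /= inE negb_or -andbA => /and4P[ij si sj us] sub.
have jd : (j < d)%N by apply: sub; rewrite mem_head.
have subs : {subset s <= gtn d} by move=> l ls; apply: sub; rewrite inE ls orbT.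
rewrite big_cons opprD [- _ - _]addrC addrA.
have [->|a0] := eqVneq (f j) 0.
  by rewrite scale0r subr0; apply: IHs => //=; rewrite si.
(* E contains the new vector, but not y_j, because a vector of E without y_i has no y_j either. *)
pose E : {vspace V} := (<[basv i - f j *: basv j]> + coordsp (mem s))%VS.
have SE : S E.
  by apply: SD; [apply/(coef_predP _ id_ jd) | apply: sublattice_coordsp].
apply: (sublattice_elim1 SE).
- by apply: IHs => //=; rewrite si.
- by rewrite vlineN vlineZ //; apply: Sbas.
- rewrite addrAC memv_add ?memv_line // rpredN big_seq rpred_sum // => l ls.
  by apply/memvZ/bas_coordsp => //; apply: subs.
apply/negP => /memv_addP[_ /vlineP[x ->] [w /mem_coordsp sw E']].
have := congr1 (coordv i) E'; have := congr1 (coordv j) E'.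
rewrite !(linearD, linearN, linearZ) /= ?(linearD, linearN, linearZ) /= !coordv_bas //.
rewrite !eqxx [j == i]eq_sym (negbTE ij) (sw i) ?(sw j) //.
rewrite !(mulr0, mulr1, addr0, oppr0, subr0, sub0r, add0r) => + x0.
by rewrite -x0 mul0r => /eqP; rewrite oppr_eq0 (negbTE a0).
Qed.

Lemma sublattice_full : S = setT.
Proof.
apply/seteqP; split=> // U _.
suff -> : U = (\sum_(i < \dim U) <[(vbasis U)`_i]>)%VS.
  by apply: sublattice_sum => i _; apply: sublattice_vline.
have /span_basis := vbasisP U.
by rewrite span_def (big_nth 0) size_tuple big_mkord => /esym.
Qed.

End Frame.
End Sublattice.

(** * Four subspaces that generate a frame *)

Section Quadruple.
Variables (F : fieldType) (V : vectType F).
Implicit Types (u v w : V) (i j l : nat) (U W : {vspace V}).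
Implicit Types (I : nat -> bool) (p : bool).

Local Notation d := (\dim (fullv : {vspace V})).

(* The span of the y_i - y_(i+1) with odd i = p, written as equations; as     *)
(* coordv vanishes from d on, this covers the unpaired last vector.           *)
Definition chainP p v := (forall j, odd j = p -> coordv j v + coordv j.+1 v = 0)
  /\ (p -> coordv 0 v = 0).

Lemma chain_subspace p : subspaceP (chainP p).
Proof.
split=> [|a u v [u1 u0] [v1 v0]]; first by split=> *; rewrite ?linear0 ?addr0.
split=> [j jp|p1]; last by rewrite linearP /= u0 // v0 // mulr0 addr0.
by rewrite !linearP /= addrACA -mulrDr u1 // v1 // mulr0 addr0.
Qed.

Definition chainsp p : {vspace V} := vset (chainP p).

Lemma chainspP p v : v \in chainsp p <-> chainP p v.
Proof. exact/mem_vset/chain_subspace. Qed.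

Variable S : set {vspace V}.
Hypothesis Slat : forall U W, S U -> S W -> S (U + W)%VS /\ S (U :&: W)%VS.
Hypothesis Spar : forall p, S (coordsp (fun j => odd j == p)).
Hypothesis Schain : forall p, S (chainsp p).

Let tl i : {vspace V} := coordsp (fun j => (i <= j)%N && (odd j == odd i)).
Let hd i : {vspace V} := coordsp (fun j => (j <= i)%N && (odd j == odd i)).

(* Knowing the tail at i.+1, the chain produces all of the tail at i except   *)
(* its first basis vector.                                                    *)
Lemma tl_rec i : tl i.+2 = (tl i :&: (tl i.+1 + chainsp (odd i.+1)))%VS.
Proof.
apply/vspaceP => v; rewrite memv_cap; apply/idP/idP.
  move=> /mem_coordsp vt; apply/andP; split.
    by apply/mem_coordsp => j nj; apply: vt; lia.
  pose u : V := vec (fun j => coordv j.+1 v).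
  have uE j : coordv j u = coordv j.+1 v.
    by rewrite coordv_vec; case: ltnP => // /leqW/coordv_out->.
  rewrite -[v](subrK u) addrC memv_add //.
    by apply/mem_coordsp => j nj; rewrite uE vt //=; lia.
  apply/chainspP; split=> [j jp|oi]; rewrite !linearB /= !uE; last first.
    by rewrite !vt ?subr0 //; lia.
  by rewrite addrA subrK !vt ?subr0 //; lia.
case/andP=> /mem_coordsp vt /memv_addP[u /mem_coordsp ut [g /chainspP[g1 g0] E]].
suff vi : coordv i v = 0.
  by apply/mem_coordsp => j nj; have [->//|ji] := eqVneq j i; apply: vt; lia.
rewrite E linearD /= ut ?add0r; last by lia.
case: i vt ut g1 g0 => [|i] vt ut g1 g0; first exact: g0.
have := g1 i; rewrite /= negbK => /(_ erefl).
suff -> : coordv i g = 0 by rewrite add0r.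
have -> : g = v - u by rewrite E addrC addKr.
by rewrite linearB /= vt ?ut ?subr0 //; lia.
Qed.

(** Mirror image of [tl_rec], with coordinates shifted up instead of down; [i.+1 < d] ensures that
    the shift loses no coordinate. *)
Lemma hd_rec i : (i.+1 < d)%N -> hd i = (hd i.+2 :&: (hd i.+1 + chainsp (odd i)))%VS.
Proof.
move=> id_; apply/vspaceP => v; rewrite memv_cap; apply/idP/idP.
  move=> /mem_coordsp vt; apply/andP; split.
    by apply/mem_coordsp => j nj; apply: vt; lia.
  pose u : V := vec (fun j => if j is j'.+1 then coordv j' v else 0).
  have uE j : coordv j u = if j is j'.+1 then coordv j' v else 0.
    by rewrite coordv_vec; case: ltnP => //; case: j => // j dj; rewrite vt //; lia.
  rewrite -[v](subrK u) addrC memv_add //.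
    by apply/mem_coordsp => -[|j] nj; rewrite uE // vt //=; lia.
  apply/chainspP; split=> [j jp|oi]; rewrite !linearB /= !uE; last first.
    by rewrite !vt ?subr0 //; lia.
  rewrite addrC subrKA [coordv j.+1 v]vt; last by lia.
  by case: j jp => [|j] jp; rewrite ?subr0 // vt ?subr0 //; lia.
case/andP=> /mem_coordsp vt /memv_addP[u /mem_coordsp ut [g /chainspP[g1 g0] E]].
suff vi : coordv i.+2 v = 0.
  by apply/mem_coordsp => j nj; have [->//|ji] := eqVneq j i.+2; apply: vt; lia.
rewrite E linearD /= ut ?add0r; last by lia.
have := g1 i.+2; rewrite /= negbK => /(_ erefl).
suff -> : coordv i.+3 g = 0 by rewrite addr0.
have -> : g = v - u by rewrite E addrC addKr.
by rewrite linearB /= vt ?ut ?subr0 //; lia.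
Qed.

Lemma sublattice_tl i : S (tl i).
Proof.
suff [] : S (tl i) /\ S (tl i.+1) by [].
elim: i => [|i [IH0 IH1]]; last first.
  split=> //; rewrite tl_rec; apply: (Slat _ _).2 => //.
  exact: (Slat _ _).1.
split; [have := Spar false|have := Spar true]; congr S; apply: eq_coordsp => j _ /=; lia.
Qed.

Lemma sublattice_hd i : S (hd i).
Proof.
(* The top two heads are the full parity spaces; the others follow by descent on i. *)
have base j : (d <= j.+2)%N -> S (hd j).
  move=> dj; have := Spar (odd j); congr S; apply: eq_coordsp => l; rewrite inE /=; lia.
have [n] := ubnP (d - i); elim: n i => // n IHn i ni.
have [/base//|id_] := leqP d i.+2.
by rewrite hd_rec ?(ltnW id_) //; apply: (Slat _ _).2; first apply: IHn; try lia;
  apply: (Slat _ _).1 => //; apply: IHn; lia.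
Qed.

Lemma coordsp1 i : (i < d)%N -> coordsp (pred1 i) = <[basv i]>%VS :> {vspace V}.
Proof.
move=> id_; apply/vspaceP => v; apply/idP/idP.
  move=> /mem_coordsp vi; apply/vlineP; exists (coordv i v); apply: coordv_inj => j.
  rewrite linearZ /= coordv_bas //; have [->|ji] := eqVneq j i; first by rewrite mulr1.
  by rewrite mulr0 vi.
move=> /vlineP[a ->]; apply/mem_coordsp => j /negbTE /= ji.
by rewrite linearZ /= coordv_bas // ji mulr0.
Qed.

Lemma sublattice_bas i : (i < d)%N -> S <[basv i]>%VS.
Proof.
move=> id_; rewrite -coordsp1 //.
suff -> : coordsp (pred1 i) = (tl i :&: hd i)%VS :> {vspace V}.
  by apply: (Slat _ _).2; [apply: sublattice_tl|apply: sublattice_hd].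
apply/vspaceP => v; rewrite memv_cap; apply/idP/andP.
  by move=> /mem_coordsp vi; split; apply/mem_coordsp => j nj; apply: vi => /=; lia.
move=> [/mem_coordsp vt /mem_coordsp vh]; apply/mem_coordsp => j /= ji.
have [jj|jj] := boolP ((i <= j)%N && (odd j == odd i)).
  by apply: vh; lia.
exact: vt.
Qed.

Lemma sublattice_succ i : (i.+1 < d)%N -> S <[basv i - 1 *: basv i.+1]>%VS.
Proof.
move=> id_; have id' := ltnW id_.
suff -> : <[basv i - 1 *: basv i.+1]>%VS =
    (chainsp (odd i) :&: (<[basv i]> + <[basv i.+1]>))%VS.
  by apply: (Slat _ _).2 => //; apply: (Slat _ _).1; apply: sublattice_bas.
apply/vspaceP => v; rewrite memv_cap; apply/idP/andP.
  move=> /vlineP[a ->]; split.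
    have E j : coordv j (a *: (basv i - 1 *: basv i.+1 : V)) =
        a * ((j == i)%:R - (j == i.+1)%:R).
      by rewrite linearZ linearB linearZ /= !coordv_bas // mul1r.
    apply/chainspP; split=> [j jp|p1]; rewrite !E; last first.
      by rewrite (_ : (0%N == i) = false) /= ?subr0 ?mulr0 //; lia.
    rewrite eqSS [j == i.+1](_ : _ = false) ?subr0; last by lia.
    rewrite [j.+1 == i](_ : _ = false) ?sub0r; last by lia.
    by rewrite -mulrDr addrN mulr0.
  by rewrite memvZ // memv_add ?memv_line // rpredN memvZ ?memv_line.
case=> /chainspP[v1 v0] /memv_addP[_ /vlineP[a ->] [_ /vlineP[b ->] E]].
apply/vlineP; exists a; rewrite E scalerBr scale1r; congr (_ + _).
rewrite -scaleNr; congr (_ *: _); apply/eqP; rewrite -addr_eq0 addrC.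
have := v1 i erefl; rewrite E !linearD !linearZ /= !coordv_bas //.
rewrite !eqxx (gtn_eqF (ltnSn i)) (ltn_eqF (ltnSn i)) => <-.
by rewrite !mulr1 !mulr0 addr0 add0r.
Qed.

End Quadruple.

Arguments chainsp {F V} p.

(** * Recovering matrix entries from graphs *)

Section Generation.
Variables (F : fieldType) (V : vectType F).
Implicit Types (u v w : V) (i j l r : nat) (U W : {vspace V}) (p : bool).
Implicit Types (A : nat -> nat -> F).

Local Notation d := (\dim (fullv : {vspace V})).

(* The graph of the map with matrix - A; A is indexed by absolute positions,  *)
(* the column index l ranging over r <= l < d.                                *)
Definition graphP r A v := forall l, (r <= l < d)%N ->
  coordv l v = - \sum_(i < r) A i l * coordv i v.

Lemma graph_subspace r A : subspaceP (graphP r A).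
Proof.
split=> [l _|a u v uP vP l ld].
  by rewrite linear0 big1 ?oppr0 // => i _; rewrite linear0 mulr0.
rewrite linearP /= uP // vP // mulrN -opprD mulr_sumr -big_split /=.
by congr (- _); apply: eq_bigr => i _; rewrite linearP /= mulrDr mulrCA.
Qed.

Definition graphsp r A : {vspace V} := vset (graphP r A).

Lemma graphspP r A v : v \in graphsp r A <-> graphP r A v.
Proof. exact/mem_vset/graph_subspace. Qed.

Variable S : set {vspace V}.
Hypothesis Slat : forall U W, S U -> S W -> S (U + W)%VS /\ S (U :&: W)%VS.
Hypothesis Spar : forall p, S (coordsp (fun j => odd j == p)).
Hypothesis Schain : forall p, S (chainsp p).
Hypothesis d3 : (3 <= d)%N.

Let Sbas i (id_ : (i < d)%N) : S <[basv i]>%VS :=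
  sublattice_bas Slat Spar Schain id_.

Lemma sublattice_diff i j : (i < d)%N -> (j < d)%N -> i != j -> scoef S i j 1.
Proof.
have lt m n : (m + n.+1 < d)%N -> scoef S m (m + n.+1)%N 1.
  elim: n => [|n IHn] md.
    by rewrite addn1; apply: (sublattice_succ Slat) => //; rewrite -addn1.
  rewrite -[1]mulr1; apply: (@scoefM _ _ _ Slat d3 Sbas m (m + n.+1)%N); try lia.
    by apply: IHn; lia.
  rewrite [(m + n.+2)%N]addnS; apply: (sublattice_succ Slat Spar Schain).
  by rewrite -addnS.
wlog ij : i j / (i < j)%N => [H|].
  move=> id_ jd ij; have [/H/(_ id_ jd ij)//|ji] := ltnP i j.
  have /H/(_ jd id_) : (j < i)%N by lia.
  rewrite eq_sym => /(_ ij); rewrite /scoef !scale1r.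
  by rewrite -opprB vlineN.
by move=> id_ jd _; have := lt i (j - i.+1)%N; rewrite -addSnnS subnKC //; apply.
Qed.

(** Meeting the graph with the span of y_i and the y_j, j >= r, leaves the line of z, the i-th row
    y_i - sum of A i j y_j. Adding back w removes all entries of that row but the l-th. *)
Lemma sublattice_graph r A i l : S (graphsp r A) -> (i < r)%N -> (r <= l < d)%N ->
  A i l \in coef_pred S.
Proof.
move=> SA ir /andP[rl ld]; have id_ : (i < d)%N by lia.
have il : i != l by lia.
apply/(coef_predP Slat d3 Sbas sublattice_diff _ id_ ld il).
pose z : V := vec (fun j => if (j < r)%N then (j == i)%:R else - A i j).
have zE j : coordv j z =
    if (j < d)%N then if (j < r)%N then (j == i)%:R else - A i j else 0.
  exact: coordv_vec.
have Sz : S <[z]>%VS.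
  suff -> : <[z]>%VS = (graphsp r A :&: coordsp (fun j => (j == i) || (r <= j)%N))%VS.
    by apply: (Slat _ _).2 => //; apply: sublattice_coordsp.
  apply/vspaceP => v; rewrite memv_cap; apply/idP/andP.
    move=> /vlineP[a ->]; split; last first.
      apply/mem_coordsp => j nj; rewrite linearZ /= zE.
      case: ifP => jd; last by rewrite mulr0.
      by case: ifP => jr; [rewrite (_ : (j == i) = false) ?mulr0 //|]; lia.
    rewrite memvZ //; apply/graphspP.
    move=> j /andP[rj jd]; rewrite zE jd ltnNge rj /=; congr (- _).
    rewrite (bigD1 (Ordinal ir)) //= zE id_ ir eqxx mulr1 big1 ?addr0 // => m mi.
    by rewrite zE ltn_ord (_ : (m == i :> nat) = false) ?if_same ?mulr0 //; apply/negbTE.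
  case=> /graphspP vg /mem_coordsp vs.
  apply/vlineP; exists (coordv i v); apply: coordv_inj => j.
  rewrite linearZ /= zE; have [jd|dj] := ltnP j d; last by rewrite mulr0 coordv_out.
  have [jr|rj] := ltnP j r.
    have [->|ji] := eqVneq j i; first by rewrite mulr1.
    by rewrite mulr0 vs //; lia.
  rewrite vg ?rj // mulrN mulrC; congr (- _).
  rewrite (bigD1 (Ordinal ir)) //= big1 ?addr0 // => m mi.
  rewrite [coordv m v]vs ?mulr0 //; have := ltn_ord m; have : m != i :> nat by [].
  by lia.
pose w : V := vec (fun j => if (r <= j)%N && (j != l) then A i j else 0).
rewrite /scoef; have -> : basv i - A i l *: basv l = z + w.
  apply: coordv_inj => j; rewrite linearB linearD linearZ /= !coordv_bas // zE coordv_vec.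
  have [jd|dj] := ltnP j d; last first.
    rewrite [j == i](_ : _ = false); last by lia.
    by rewrite [j == l](_ : _ = false) ?mulr0 ?subr0 ?addr0 //; lia.
  have [jr|rj] := ltnP j r.
    by rewrite [j == l](_ : _ = false) ?mulr0 ?subr0 ?addr0 //; lia.
  rewrite [j == i](_ : _ = false); last by lia.
  by have [->|jl] := eqVneq j l; rewrite /= ?mulr1 ?mulr0 ?subr0 ?sub0r ?addr0 // addNr.
apply: (@sublattice_elim _ _ _ Slat z w (coordsp (pred2 i l))
   (coordsp (fun j => (r <= j)%N && (j != l)))) => //; try exact: sublattice_coordsp.
- apply/mem_coordsp => j nj; rewrite coordv_vec (negbTE nj) if_same //.
- apply/mem_coordsp => j; rewrite linearD /= zE coordv_vec negb_or.
  move=> /andP[/negbTE -> jl]; rewrite jl andbT; case: ifP; rewrite ?addr0 // => _.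
  by case: ltnP; rewrite ?addr0 // addNr.
move=> x /mem_coordsp xW /mem_coordsp xE; apply: coordv_inj => j; rewrite linear0.
have [jil|jil] := boolP (pred2 i l j); last exact: xE.
by apply: xW; move: jil => /=; lia.
Qed.

Lemma quadruple_graphs_full (T : Type) r (A : T -> nat -> nat -> F) :
  (forall t, S (graphsp r (A t))) ->
  field_generates [set x | exists t i l, [/\ (i < r)%N, (r <= l < d)%N & A t i l = x]] ->
  S = setT.
Proof.
move=> SA /(_ (coef_pred S) (coef_pred_divring Slat d3 Sbas sublattice_diff)) KT.
apply: (sublattice_full Slat d3 Sbas sublattice_diff); apply: KT.
by move=> _ [t [i [l [ir rl <-]]]]; apply: (sublattice_graph (SA t)).
Qed.

End Generation.

Arguments graphsp {F V} r A.

(** * Direct powers *)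

Definition sublattice disp (L : latticeType disp) (S : set L) : Prop :=
  forall x y, S x -> S y -> S (Order.join x y) /\ S (Order.meet x y).

Section Powers.
Variables (F : fieldType) (V : vectType F) (k : nat).
Implicit Types (U W : {vspace V}) (i j : 'I_k) (n : nat).

Local Notation L := ({vspace V} : latticeType vspace_display).
Local Notation Lk := (k.-tupleprod L)%type.
Implicit Types (s t : Lk).

Lemma tnth_joinv s t i : tnth (Order.join s t) i = (tnth s i + tnth t i)%VS.
Proof. exact: tnth_mktuple. Qed.

Lemma tnth_meetv s t i : tnth (Order.meet s t) i = (tnth s i :&: tnth t i)%VS.
Proof. exact: tnth_mktuple. Qed.

Variable S : set Lk.
Hypothesis Slat : sublattice S.

(** Each component of t is cut out by the tuple that is V at i and 0 elsewhere, and the pieces are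
    joined. *)
Lemma sublattice_power_full : (0 < k)%N ->
  (forall i U, exists2 s, S s & tnth s i = U) ->
  (forall i, exists2 s, S s & tnth s i = fullv /\ forall j, j != i -> tnth s j = 0%VS) ->
  S = setT.
Proof.
move=> k0 Sproj Sind; apply/seteqP; split=> // t _.
have block i : exists2 s, S s &
    tnth s i = tnth t i /\ forall j, j != i -> tnth s j = 0%VS.
  have [s Ss sti] := Sproj i (tnth t i); have [e Se [ei ej]] := Sind i.
  exists (Order.meet s e); first exact: (Slat Ss Se).2.
  split=> [|j ji]; rewrite tnth_meetv ?ei ?sti ?ej ?capvf ?capv0 //.
suff /(_ k (leqnn k))[s Ss st] : forall n, (n <= k)%N -> exists2 s, S s &
    forall j, tnth s j = if (j < n)%N then tnth t j else 0%VS.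
  suff -> : t = s by [].
  by apply: eq_from_tnth => j; rewrite st ltn_ord.
elim=> [_|n IHn nk]; last first.
  have [s Ss sj] := IHn (ltnW nk); have [e Se [ei ej]] := block (Ordinal nk).
  exists (Order.join s e); first exact: (Slat Ss Se).1.
  move=> j; rewrite tnth_joinv sj; have [jn|jn] := eqVneq j (Ordinal nk).
    by rewrite jn ei /= ltnn ltnSn add0v.
  rewrite ej // addv0 ltnS [in RHS]leq_eqVlt.
  rewrite (_ : (val j == n) = false) //.
  by apply: contraNF jn => /eqP ?; apply/eqP/val_inj.
have [s Ss s0] := Sproj (Ordinal k0) 0%VS.
have [e Se [ei ej]] := Sind (Ordinal k0).
exists (Order.meet s e) => [|j]; first exact: (Slat Ss Se).2.
rewrite tnth_meetv; have [->|j0] := eqVneq j (Ordinal k0).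
  by rewrite s0 cap0v.
by rewrite ej // capv0.
Qed.

Hypothesis Sdiag : forall U, S [tuple U | _ < k].

Let Sjoin s t : S s -> S t -> S (Order.join s t).
Proof. by move=> Ss St; have [] := Slat Ss St. Qed.

Let Smeet s t : S s -> S t -> S (Order.meet s t).
Proof. by move=> Ss St; have [] := Slat Ss St. Qed.

(** A perspectivity moves [<[v]>] to any other line [<[x]>]: joining s with the constant [<[v + x]>]
    and meeting with the constant [<[x]>] gives [<[x]>] at i and 0 at j. Joining over a basis gives
    V at i. *)
Lemma separate_line (v : V) i j s : v != 0 -> S s ->
    tnth s i = <[v]>%VS -> tnth s j = 0%VS ->
  exists2 e, S e & tnth e i = fullv /\ tnth e j = 0%VS.
Proof.
move=> v0 Ss si sj.
have line x : exists2 e, S e & tnth e i = <[x]>%VS /\ tnth e j = 0%VS.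
  pose a := if x \in <[v]>%VS then 0%VS else <[v + x]>%VS.
  exists (Order.meet (Order.join s [tuple a | _ < k]) [tuple <[x]>%VS | _ < k]).
    by apply: Smeet => //; apply: Sjoin.
  rewrite !tnth_meetv !tnth_joinv si sj !tnth_mktuple add0v; split.
    apply/capv_idPr; rewrite -memvE /a; case: ifP => xv; first by rewrite addv0.
    by rewrite -[x in x \in _](addKr v) memv_add ?rpredN ?memv_line.
  apply/eqP; rewrite -subv0; apply/subvP => y; rewrite memv0 /a.
  case: ifP => xv /memv_capP[]; first by rewrite memv0.
  move=> /vlineP[b ->] /vlineP[c] E; have [->|b0] := eqVneq b 0; first by rewrite scale0r.
  have vE : v = (b^-1 * c - 1) *: x.
    by rewrite scalerBl -scalerA -E scalerK // scale1r addrK.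
  have c0 : b^-1 * c - 1 != 0 by apply: contraNneq v0 => c0; rewrite vE c0 scale0r.
  by move: xv; rewrite vE vlineZ // memv_line.
suff /(_ (\dim (fullv : {vspace V})))[e Se [ei ej]] : forall n, exists2 e, S e &
    tnth e i = (\sum_(m < n) <[(vbasis fullv)`_m : V]>)%VS /\ tnth e j = 0%VS.
  exists e => //; split=> //; rewrite ei.
  have := vbasisP (fullv : {vspace V}) => /span_basis.
  by rewrite span_def (big_nth 0) size_tuple big_mkord.
elim=> [|n [e Se [ei ej]]].
  by exists [tuple 0%VS | _ < k] => //; rewrite !tnth_mktuple big_ord0.
have [e' Se' [e'i e'j]] := line (vbasis fullv)`_n.
exists (Order.join e e'); first exact: Sjoin.
by rewrite !tnth_joinv ei ej e'i e'j addv0 big_ord_recr.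
Qed.

(** A vector v in W i but not in W j gives a tuple, the constant [<[v]>] met with W, to which
    [separate_line] applies; meeting the results over all j other than i isolates coordinate i. *)
Lemma sublattice_diag_full (W : 'I_k -> {vspace V}) : (0 < k)%N ->
  (forall i j, i != j -> ~~ (W i <= W j)%VS) -> S [tuple W i | i < k] -> S = setT.
Proof.
move=> k0 Winc SW; apply: sublattice_power_full => // [i U|i].
  by exists [tuple U | _ < k] => //; rewrite tnth_mktuple.
have sep j : j != i -> exists2 e, S e & tnth e i = fullv /\ tnth e j = 0%VS.
  rewrite eq_sym => ij; have [v vi vj] := subvPn (Winc i j ij).
  have v0 : v != 0 by apply: contraNneq vj => ->; rewrite mem0v.
  pose s : Lk := Order.meet ([tuple <[v]>%VS | _ < k] : Lk) [tuple W i | i < k].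
  apply: (@separate_line v i j s) => //.
  - by apply: Smeet.
  - by rewrite tnth_meetv !tnth_mktuple; apply/capv_idPl; rewrite -memvE.
  rewrite tnth_meetv !tnth_mktuple; apply/eqP; rewrite -subv0.
  apply/subvP => y /memv_capP[/vlineP[a ->]]; have [->|a0] := eqVneq a 0.
    by rewrite scale0r => _; apply: mem0v.
  by move=> aW; rewrite -(scalerK a0 v) memvZ // in vj.
suff /(_ k)[e Se [ei ej]] : forall n, exists2 e, S e &
    tnth e i = fullv /\ forall j, (j < n)%N -> j != i -> tnth e j = 0%VS.
  by exists e => //; split=> // j ji; apply: ej.
elim=> [|n [e Se [ei ej]]].
  by exists [tuple fullv | _ < k] => //; split=> [|[]] //; rewrite tnth_mktuple.
have [nk|kn] := ltnP n k; last first.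
  by exists e => //; split=> // j _; apply: ej; apply: leq_trans kn.
have [ni|ni] := eqVneq (Ordinal nk) i.
  exists e => //; split=> // j; rewrite ltnS leq_eqVlt => /orP[/eqP jn|jn] ji.
    by case/eqP: ji; rewrite -ni; apply: val_inj.
  exact: ej.
have [e' Se' [e'i e'j]] := sep _ ni.
exists (Order.meet e e'); first exact: Smeet.
rewrite tnth_meetv ei e'i capvv; split=> // j jn ji; rewrite tnth_meetv.
have [->|jn'] := eqVneq j (Ordinal nk); first by rewrite e'j capv0.
rewrite ej ?cap0v // ltn_neqAle -ltnS jn andbT.
by apply: contraNneq jn' => ?; apply/eqP/val_inj.
Qed.

End Powers.

(** * Upper bound for the power *)

Section UpperBound.
Variables (F : fieldType) (V : vectType F) (k : nat).
Local Notation d := (\dim (fullv : {vspace V})).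
Local Notation L := ({vspace V} : latticeType vspace_display).
Local Notation Lk := (k.-tupleprod L)%type.

Lemma graph_family_ex (T : Type) (X : set F) (M : Type) (r : nat) :
  card_eq (@setT T) X -> (r < d)%N -> (T <=c M * 'I_(r * (d - r)))%type ->
  exists A : M -> nat -> nat -> F, X `<=`
    [set x | exists t i l, [/\ (i < r)%N, (r <= l < d)%N & A t i l = x]].
Proof.
move=> /card_eq_range[g ginj <-] rd /card_le_injP[f finj].
(* Row-major numbering of the r (d - r) matrix positions; positions that receive no generator are
   filled with 0. *)
pose code i l := (i * (d - r) + (l - r))%N.
exists (fun t i l => xget 0 [set x | exists s, [/\ g s = x, (f s).1 = t &
   val (f s).2 = code i l]]).
move=> _ [s _ <-]; have dr : (0 < d - r)%N by rewrite subn_gt0.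
exists (f s).1, (val (f s).2 %/ (d - r))%N, (r + val (f s).2 %% (d - r))%N.
have m_lt := ltn_pmod (val (f s).2) dr.
split; first by rewrite ltn_divLR //; apply: ltn_ord.
  by rewrite leq_addr /= -ltn_subRL.
case: xgetP => [x _ [s' [<- E1 E2]]|/(_ (g s))[]]; last first.
  by exists s; split=> //; rewrite /code addKn -divn_eq.
congr g; apply: finj; rewrite [f s]surjective_pairing [f s']surjective_pairing E1.
by congr (_, _); apply: val_inj; rewrite /= E2 /code addKn -divn_eq.
Qed.

Lemma power_upper_bound (M : Type) (W : 'I_k -> {vspace V}) (r : nat) :
  (3 <= d)%N -> (0 < k)%N -> (forall i j, i != j -> ~~ (W i <= W j)%VS) ->
  (r < d)%N -> (mng_field F <=c M * 'I_(r * (d - r)))%type ->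
  (mng_lattice Lk <=c 'I_5 + M)%type.
Proof.
move=> d3 k0 Winc rd Mle; have [[X genX X_eq] _] := mng_fieldP F.
have [A XA] := graph_family_ex X_eq rd Mle.
pose diag (U : {vspace V}) : Lk := [tuple U | _ < k].
pose gen (x : 'I_5 + M) : Lk := match x with
  (* The fifth generator, the tuple W, is the default of [nth], reached at index 4. *)
  | inl i => nth [tuple W i | i < k] [:: diag (coordsp (fun j => odd j == false));
       diag (coordsp (fun j => odd j == true)); diag (chainsp false);
       diag (chainsp true)] i
  | inr t => diag (graphsp r (A t)) end.
have genL : lattice_generates (range gen).
  move=> S Slat genS.
  have Sg x : S (gen x) by apply: genS; exists x.
  have diagS : [set U | S (diag U)] = setT.
    have djoin U1 U2 : diag (U1 + U2)%VS = Order.join (diag U1) (diag U2).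
      by apply: eq_from_tnth => i; rewrite tnth_joinv !tnth_mktuple.
    have dmeet U1 U2 : diag (U1 :&: U2)%VS = Order.meet (diag U1) (diag U2).
      by apply: eq_from_tnth => i; rewrite tnth_meetv !tnth_mktuple.
    apply: (@quadruple_graphs_full F V _ _ _ _ d3 M r A) => /=.
    - by move=> U1 U2 S1 S2; rewrite /= djoin dmeet; apply: Slat.
    - by case; [have := Sg (inl (@Ordinal 5 1 isT))|have := Sg (inl (@Ordinal 5 0 isT))].
    - by case; [have := Sg (inl (@Ordinal 5 3 isT))|have := Sg (inl (@Ordinal 5 2 isT))].
    - by move=> t; apply: (Sg (inr t)).
    exact: field_generatesW genX.
  apply: (@sublattice_diag_full _ _ _ S Slat _ W) => //.
    by move=> U; have : [set U | S (diag U)] U by rewrite diagS.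
  exact: (Sg (inl (@Ordinal 5 4 isT))).
apply: card_le_trans ((mng_latticeP Lk).2 _ genL) _; exact: card_range_le.
Qed.

End UpperBound.

(** * Subspaces rational over a subfield *)

(** K as a field type of its own, so that matrices over K and their extension of scalars to F make
    sense. *)
Record subfield (F : fieldType) (K : divringClosed F) :=
  Subfield {sf_val :> F; _ : sf_val \in K}.

Section SubfieldType.
Variables (F : fieldType) (K : divringClosed F).

HB.instance Definition _ := [isSub for @sf_val F K].
HB.instance Definition _ := [Choice of subfield K by <:].
HB.instance Definition _ := [SubChoice_isSubComUnitRing of subfield K by <:].
HB.instance Definition _ := [SubComUnitRing_isSubIntegralDomain of subfield K by <:].
HB.instance Definition _ := [SubIntegralDomain_isSubField of subfield K by <:].

End SubfieldType.

Import VectorInternalTheory.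

Section RationalSubspaces.
Variables (F : fieldType) (K : divringClosed F) (V : vectType F).
Local Notation d := (dim V).
Local Notation sfv := (\val : subfield K -> F).

Definition rational (U : {vspace V}) : Prop :=
  exists A : 'M[subfield K]_d, (vs2mx U :=: map_mx sfv A)%MS.

Lemma mx_rational m (B : 'M[F]_(m, d)) (U : {vspace V}) :
  (forall i j, B i j \in K) -> (vs2mx U :=: B)%MS -> rational U.
Proof.
move=> BK UB; exists <<\matrix_(i, j) (Subfield (BK i j) : subfield K)>>%MS.
apply: eqmx_trans UB _; apply: eqmx_sym; apply: eqmx_trans (map_genmx _ _) _.
rewrite (_ : map_mx sfv _ = B); first exact: genmxE.
by apply/matrixP => i j; rewrite !mxE.
Qed.

(** Sums and intersections of row spaces commute with extension of scalars. *)
Lemma rational_sublattice :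
  @sublattice _ ({vspace V} : latticeType vspace_display) [set U | rational U].
Proof.
move=> U W [A UA] [B WB]; split.
  exists (A + B)%MS; apply: eqmx_trans (mx2vsK _) _.
  exact: eqmx_trans (adds_eqmx UA WB) (eqmx_sym (map_addsmx _ _ _)).
exists (A :&: B)%MS; apply: eqmx_trans (mx2vsK _) _.
exact: eqmx_trans (cap_eqmx UA WB) (eqmx_sym (map_capmx _ _ _)).
Qed.

(** A nonzero K-rational vector on the line of (1, x, 0, ..., 0) exhibits x as a quotient of two
    elements of K. *)
Lemma rational_all : (1 < d)%N -> (forall U, rational U) -> forall x, x \in K.
Proof.
move=> d1 Urat x.
pose i0 := Ordinal (ltnW d1); pose i1 := Ordinal d1.
pose v : 'rV[F]_d := delta_mx 0 i0 + x *: delta_mx 0 i1.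
have [A] := Urat (mx2vs v).
move/(eqmx_trans (eqmx_sym (mx2vsK v))) => vA.
have [i Ai] : exists i, row i A != 0.
  apply/existsP; rewrite -[[exists _, _]]negbK negb_exists.
  apply/negP => /forallP A0; have : v == 0.
    rewrite -submx0 vA (_ : A = 0) ?map_mx0 ?submx_refl //.
    by apply/row_matrixP => j; rewrite row0; apply/eqP; rewrite -[_ == _]negbK.
  move=> /eqP/rowP/(_ i0); rewrite !mxE /= mulr0 addr0.
  by move/eqP; rewrite oner_eq0.
have : (row i (map_mx sfv A) <= v)%MS by rewrite vA row_sub.
move=> /sub_rVP[a Ea]; have Ej j : sfv (A i j) = a * v 0 j.
  by have := congr1 (fun w : 'rV_d => w 0 j) Ea; rewrite !mxE.
have a0 : a = sfv (A i i0) by rewrite Ej !mxE /= mulr0 addr0 mulr1.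
have a1 : a * x = sfv (A i i1) by rewrite Ej !mxE /= add0r mulr1.
have an0 : a != 0.
  apply: contraNneq Ai => a0'; apply/eqP/rowP => j; rewrite !mxE.
  by apply: val_inj; rewrite /= -[RHS](mul0r (v 0 j)) -a0' -Ej.
rewrite -(mulKf an0 x) a1 a0; apply: rpredM; last exact: valP.
by rewrite rpredV; apply: valP.
Qed.

End RationalSubspaces.

(** Select r independent columns and multiply by the inverse of that minor. *)
Lemma reduced_mx_ex (F : fieldType) (r d : nat) (A : 'M[F]_(r, d)) : row_free A ->
  exists g : 'I_r -> 'I_d, injective g /\
  exists2 B : 'M[F]_(r, d), (A :=: B)%MS & forall i j, B i (g j) = (i == j)%:R.
Proof.
move=> fA; have fT : row_full A^T by rewrite /row_full mxrank_tr.
exists (fullrankfun fT); split; first exact: fullrankfun_inj.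
have := fullrowsub_unit fT; rewrite -unitmx_tr.
set C := (rowsub _ _)^T => uC; exists (invmx C *m A).
  by apply/eqmx_sym/eqmxMfull; rewrite row_full_unit unitmx_inv.
move=> i j; have := congr1 (fun M : 'M_r => M i j) (mulVmx uC).
rewrite [in X in _ = X -> _]mxE => <-; rewrite !mxE.
by apply: eq_bigr => l _; rewrite !mxE.
Qed.

(** * Lower bound by counting matrix entries *)

Section LowerBound.
Variables (F : fieldType) (V : vectType F).
Local Notation d := (\dim (fullv : {vspace V})).

Lemma rational_entries_ex (n : nat) (U : {vspace V}) :
  (\dim U * (d - \dim U) <= n)%N ->
  exists c : 'I_n -> F, forall K : divringClosed F, (forall m, c m \in K) -> rational K U.
Proof.
rewrite dimvf; have := reduced_mx_ex (row_base_free (vs2mx U)).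
move=> [g [ginj [B UB Bg]]] rn.
pose P : pred ('I_(\dim U) * 'I_(dim V)) := [predX predT & [predC codom g]].
pose e := [seq B p.1 p.2 | p <- enum P].
have se : (size e <= n)%N.
  rewrite size_map -cardE cardX card_ord.
  apply: leq_trans rn; rewrite leq_mul2l leq_subRL ?rank_leq_row //.
  have := cardC (mem (codom g)); rewrite (card_codom ginj) !card_ord => E.
  by rewrite -[leqRHS]E leqnn orbT.
(* Only the entries outside the identity columns are listed; the list is padded with 0 up to length
   n. *)
exists (fun m => e`_m) => K eK; apply: (@mx_rational _ _ _ _ B).
  move=> i j; have [/codomP[j' ->]|jg] := boolP (j \in codom g).
    by rewrite Bg; case: eqP => _; rewrite ?rpred1 ?rpred0.
  have Be : B i j \in e by apply/mapP; exists (i, j); rewrite ?mem_enum.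
  have lt_n : (index (B i j) e < n)%N by apply: leq_trans se; rewrite index_mem.
  by have := eK (Ordinal lt_n); rewrite /= nth_index.
by apply: eqmx_trans UB; apply: eqmx_sym; apply: eq_row_base.
Qed.

(** A subfield containing the n scalars of each lattice generator makes every generator rational,
    hence every subspace, and so is F by [rational_all]. *)
Lemma mng_field_le_mul (n : nat) : (1 < d)%N ->
  (forall r, (r <= d)%N -> (r * (d - r) <= n)%N) ->
  (mng_field F <=c mng_lattice ({vspace V} : latticeType vspace_display) * 'I_n)%type.
Proof.
move=> d1 dn; have [[X genX /card_eq_range[g _ gX]] _] :=
  mng_latticeP ({vspace V} : latticeType vspace_display).
have dU (U : {vspace V}) : (\dim U <= d)%N by rewrite dimvS ?subvf.
pose c U := sval (cid (rational_entries_ex (dn _ (dU U)))).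
have cP U : forall K : divringClosed F, (forall m, c U m \in K) -> rational K U.
  by rewrite /c; case: cid.
pose E (x : mng_lattice ({vspace V} : latticeType vspace_display) * 'I_n) :=
  c (g x.1) x.2.
apply: card_le_trans (card_range_le E); apply: (mng_fieldP F).2.
move=> K Kc EK x.
pose K' : divringClosed F := HB.pack K (GRing.isDivringClosed.Build F K Kc).
have ratT : [set U : {vspace V} | rational K' U] = setT.
  apply: genX; first exact: rational_sublattice.
  by rewrite -gX => _ [s _ <-]; apply: cP => m; apply: EK; exists (s, m).
apply: (@rational_all F K' V _ _ x); first by rewrite -dimvf.
by move=> U; have : [set U : {vspace V} | rational K' U] U by rewrite ratT.
Qed.

End LowerBound.

Lemma mng_lattice_power_ge (F : fieldType) (V : vectType F) (k : nat) : (0 < k)%N ->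
  (mng_lattice ({vspace V} : latticeType vspace_display) <=c
   mng_lattice (k.-tupleprod ({vspace V} : latticeType vspace_display)))%type.
Proof.
move=> k0; pose L : latticeType vspace_display := {vspace V}.
have [[X genX X_eq] _] := mng_latticeP (k.-tupleprod L)%type.
pose p (s : (k.-tupleprod L)%type) : L := tnth s (Ordinal k0).
have genpX : lattice_generates [set p s | s in X].
  move=> S Slat XS; suff pS : [set s | S (p s)] = setT.
    apply/seteqP; split=> // U _.
    have : [set s | S (p s)] [tuple U | _ < k] by rewrite pS.
    by rewrite /= /p tnth_mktuple.
  apply: genX => [s t Ss St|s Xs] /=; last by apply: XS; exists s.
  by rewrite /p tnth_joinv tnth_meetv; apply: Slat.
apply: card_le_trans ((mng_latticeP L).2 _ genpX) _.
apply: card_le_trans (card_image_le _ _) _.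
by move: X_eq; rewrite card_eq_le => /andP[].
Qed.

(** * Antichains of subspaces *)

Section GaussRecurrence.
Variable q : nat.
Hypothesis q1 : (1 < q)%N.

Lemma gauss_binomial0 m : gauss_binomial m 0 q = 1%N.
Proof.
by apply/eqP; rewrite -(eqr_nat rat) gauss_binomialE // !big_ord0 divr1.
Qed.

Lemma gauss_binomial0S r : gauss_binomial 0 r.+1 q = 0%N.
Proof.
by apply/eqP; rewrite -(eqr_nat rat) gauss_binomialE // big_ord_recl subrr !mul0r.
Qed.

Lemma gauss_binomialS m r : gauss_binomial m.+1 r.+1 q =
  (gauss_binomial m r q + q ^ r.+1 * gauss_binomial m r.+1 q)%N.
Proof.
apply/eqP; rewrite -(eqr_nat rat) natrD natrM natrX !gauss_binomialE //.
have den0 n : \prod_(i < n) (1 - q%:R ^+ i.+1) != 0 :> rat.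
  apply/prodf_neq0 => i _; rewrite subr_eq0 eq_sym -natrX pnatr_eq1.
  by rewrite -(expn0 q) eqn_exp2l.
rewrite big_ord_recl subn0; under eq_bigr do rewrite /= /bump add1n subSS.
have := den0 r.+1; rewrite !big_ord_recr /= mulf_eq0 negb_or => /andP[D0 q0].
set N := \prod_(i < r) (1 - _ ^+ (m - _)); set D := \prod_(i < r) _.
have [rm|mr] := leqP r m; last first.
  have -> : N = 0 by rewrite /N (bigD1 (Ordinal mr)) //= subnn subrr mul0r.
  by rewrite !(mulr0, mul0r) addr0.
have -> : q%:R ^+ m.+1 = q%:R ^+ r.+1 * q%:R ^+ (m - r) :> rat.
  by rewrite -exprD addSn subnKC.
by apply/eqP; field; rewrite D0 q0.
Qed.

End GaussRecurrence.

Section MatrixFamily.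
Variables (F : fieldType) (q : nat) (h : 'I_q -> F).
Hypotheses (q1 : (1 < q)%N) (hinj : injective h).

Let antichain m r (I : Type) (f : I -> 'M[F]_(r, m)) :=
  (forall i, row_free (f i)) /\ forall i j, (f i <= f j)%MS -> i = j.

(** This realises the recurrence [gauss_binomialS]: a row space either contains the first unit
    vector, or is the graph of a linear form on an (r+1)-dimensional space, with q^(r+1) choices for
    the first column. *)
Let antichainS m r (I J : Type) (f : I -> 'M[F]_(r, m)) (g : J -> 'M[F]_(r.+1, m)) :
  antichain f -> antichain g ->
  antichain (fun x : I + {ffun 'I_r.+1 -> 'I_q} * J => match x with
    | inl i => block_mx 1%:M 0 0 (f i) : 'M_(1 + r, 1 + m)
    | inr cj => row_mx (\col_a h (cj.1 a)) (g cj.2) end).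
Proof.
move=> [ff fle] [gf gle]; split=> [[i|[c j]]|[i|[c j]] [i'|[c' j']]].
- by rewrite /row_free rank_diag_block_mx mxrank1 (eqP (ff i)).
- rewrite -kermx_eq0 -submx0; apply/rV_subP => u /sub_kermxP.
  rewrite mul_mx_row -[0 in X in X -> _](row_mx0 F 1 1 m) => /eq_row_mx[_ ug].
  by rewrite submx0 -(mulmx_free_eq0 u (gf j)) ug.
- move=> /submxP[X]; rewrite -[X]submxK mulmx_block !mulmx0 !mulmx1 !add0r !addr0.
  by move=> /eq_block_mx[_ _ _ E]; congr inl; apply: fle; rewrite E submxMl.
- move=> le; have : ((row_mx 1%:M 0 : 'M[F]_(1, 1 + m)) <=
      (block_mx 1%:M 0 0 (f i) : 'M[F]_(1 + r, 1 + m)))%MS.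
    by rewrite /block_mx -addsmxE addsmxSl.
  move=> /submx_trans/(_ le)/submxP[X]; rewrite mul_mx_row => /eq_row_mx[E1].
  move=> /esym/eqP; rewrite (mulmx_free_eq0 _ (gf j')) => /eqP X0.
  by move: E1; rewrite X0 mul0mx => /matrixP/(_ 0 0)/eqP; rewrite !mxE eqxx oner_eq0.
- move=> /submxP[X]; rewrite -[X]hsubmxK mul_row_block !mulmx0 !mulmx1 !add0r !addr0.
  move=> /eq_row_mx[_ E]; have := gf j; rewrite /row_free E => /eqP rk.
  have := leq_trans (mxrankM_maxr (rsubmx X) (f i')) (rank_leq_row _).
  by rewrite rk ltnn.
move=> /submxP[X]; rewrite mul_mx_row => /eq_row_mx[Ec E].
have jj' : j = j' by apply: gle; rewrite /= E submxMl.
have X1 : X = 1%:M.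
  by apply: (row_free_inj (gf j')); rewrite -E mul1mx -jj'.
move: Ec; rewrite X1 mul1mx jj' => /matrixP Ec; congr (inr (_, _)).
by apply/ffunP => a; have := Ec a 0; rewrite !mxE => /hinj.
Qed.

Lemma matrix_family_ex m r :
  exists f : 'I_(gauss_binomial m r q) -> 'M[F]_(r, m), antichain f.
Proof.
suff [I [If [f fP]]] : exists I : finType, #|I| = gauss_binomial m r q /\
    exists f : I -> 'M[F]_(r, m), antichain f.
  rewrite -If; exists (f \o enum_val); split=> [i|i j]; first exact: fP.1.
  by move=> /fP.2/enum_val_inj.
elim: m r => [|m IHm] [|r].
- exists 'I_1; rewrite card_ord gauss_binomial0 //; split=> //.
  exists (fun=> 0); split=> [i|i j _]; first by rewrite /row_free mxrank0.
  by rewrite (ord1 i) (ord1 j).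
- exists 'I_0; rewrite card_ord gauss_binomial0S //; split=> //.
  by exists (fun=> 0); split=> [[]|[]].
- exists 'I_1; rewrite card_ord gauss_binomial0 //; split=> //.
  exists (fun=> 0); split=> [i|i j _]; first by rewrite /row_free mxrank0.
  by rewrite (ord1 i) (ord1 j).
have [I [If [f fP]]] := IHm r; have [J [Jf [g gP]]] := IHm r.+1.
exists (I + {ffun 'I_r.+1 -> 'I_q} * J)%type; split.
  by rewrite card_sum card_prod card_ffun !card_ord If Jf gauss_binomialS.
by eexists; apply: antichainS fP gP.
Qed.

End MatrixFamily.

Section SubspaceFamily.
Variables (F : fieldType) (V : vectType F) (k : nat).
Local Notation d := (\dim (fullv : {vspace V})).

Lemma subspace_antichain_ex r : (1 < d)%N -> ('I_k <=c cgauss_binomial d r F)%type ->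
  exists W : 'I_k -> {vspace V}, forall i j, i != j -> ~~ (W i <= W j)%VS.
Proof.
move=> d1; have [[q Fq]|Finf] := pselect (finite_set [set: F]); last first.
  rewrite cgauss_binomial_inf // => /card_le_injP[f finj].
  (* For infinite F, mu is the cardinal of F and the lines of one plane suffice. *)
  exists (fun i => <[basv 0 + f i *: basv 1]>%VS) => i j.
  apply: contra; rewrite -memvE => /vlineP[a E]; apply/eqP/finj.
  have := congr1 (coordv 1) E; have := congr1 (coordv 0) E.
  rewrite !(linearD, linearZ) /= ?(linearD, linearZ) /= !coordv_bas ?(ltnW d1) //=.
  by rewrite !mulr0 !mulr1 !addr0 !add0r mulr1 => <-; rewrite mul1r.
rewrite (cgauss_binomial_fin _ _ Fq) dimvf => /card_le_injP[f finj].
have FIq : (F =c 'I_q)%type := card_eq_trans Fq card_II.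
have [h hinj] : exists h : 'I_q -> F, injective h.
  by apply/card_le_injP/card_eqc_le/card_eqc_sym.
have q1 : (1 < q)%N.
  have [e einj] := (card_le_injP _ _).1 (card_eqc_le FIq).
  rewrite ltnNge; apply/negP => q1.
  suff /einj/eqP : e 0 = e 1 by rewrite eq_sym oner_eq0.
  by apply: val_inj; case: (e 0) (e 1) => [x xq] [y yq] /=; lia.
have [g [_ gle]] := matrix_family_ex q1 hinj (dim V) r.
exists (fun i => mx2vs (g (f i))) => i j; apply: contra => le; apply/eqP/finj/gle.
by move: le; rewrite /subsetv !mx2vsK.
Qed.

End SubspaceFamily.

(** * Linear maps between the components of generators *)

Section HomSpaces.
Variables (F : fieldType) (V W : vectType F).
Local Notation dV := (\dim (fullv : {vspace V})).
Local Notation dW := (\dim (fullv : {vspace W})).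
Implicit Types (A : {vspace V}) (B : {vspace W}) (H : {vspace 'Hom(V, W)}).

(** H' is the kernel of the map taking phi to phi v modulo B, whose values lie in a complement of
    B. *)
Lemma hom_vec_constraint H (v : V) B : exists2 H', (H' <= H)%VS &
  (\dim H <= \dim H' + (dW - \dim B))%N /\ forall phi, phi \in H' -> phi v \in B.
Proof.
pose p := daddv_pi (B^C)%VS B; pose ev (phi : 'Hom(V, W)) : W := p (phi v).
have ev_lin : linear ev by move=> a f g; rewrite /ev lfunE /= lfunE /= linearP.
pose evL : {linear 'Hom(V, W) -> W} :=
  HB.pack ev (GRing.isLinear.Build F _ W *:%R ev ev_lin).
exists (H :&: lker (linfun evL))%VS; first exact: capvSl.
split=> [|phi].
  rewrite -(limg_ker_dim (linfun evL) H) leq_add2l -dimv_compl dimvS //.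
  by apply/subvP => _ /memv_imgP[phi _ ->]; rewrite lfunE /= memv_pi.
case/memv_capP => _; rewrite memv_ker lfunE /= => /eqP p0.
have BC : (B^C :&: B = 0)%VS by rewrite capvC capv_compl.
have := @daddv_pi_add _ _ (B^C)%VS B (phi v) BC.
rewrite addvC addv_complf memvf -/p [p _]p0 add0r => /(_ isT) <-.
exact: memv_pi.
Qed.

Lemma hom_constraint H A B : exists2 H', (H' <= H)%VS &
  (\dim H <= \dim H' + \dim A * (dW - \dim B))%N /\
  forall phi, phi \in H' -> (phi @: A <= B)%VS.
Proof.
suff /(_ (vbasis A)) [H' HH' [dH H'P]] : forall s : seq V, exists2 H', (H' <= H)%VS &
    (\dim H <= \dim H' + size s * (dW - \dim B))%N /\
    forall phi, phi \in H' -> forall v, v \in s -> phi v \in B.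
  exists H' => //; rewrite size_tuple in dH; split=> // phi /H'P phiB.
  rewrite -{1}(span_basis (vbasisP A)) limg_span; apply/span_subvP.
  by move=> _ /mapP[v vA ->]; apply: phiB.
elim=> [|v s [H1 HH1 [dH1 H1P]]].
  by exists H; rewrite ?subvv // addn0; split=> // phi _ v; rewrite in_nil.
have [H2 H21 [dH2 H2P]] := hom_vec_constraint H1 v B.
exists H2; first exact: subv_trans HH1; split=> [|phi phiH2 w].
  by apply: leq_trans dH1 _; rewrite mulSn addnA leq_add2r.
rewrite inE => /orP[/eqP->|ws]; first exact: H2P.
by apply: H1P => //; apply: (subvP H21).
Qed.

Lemma hom_constraints n (A : 'I_n -> {vspace V}) (B : 'I_n -> {vspace W}) :
  exists2 H, (dV * dW <= \dim H + \sum_(i < n) \dim (A i) * (dW - \dim (B i)))%N &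
  forall phi, phi \in H -> forall i, (phi @: A i <= B i)%VS.
Proof.
elim: n A B => [|n IHn] A B.
  exists fullv => [|phi _ []] //; rewrite big_ord0 addn0 !dimvf.
  exact: leqnn.
have [H1 dH1 H1P] := IHn (A \o lift ord0) (B \o lift ord0).
have [H2 H21 [dH2 H2P]] := hom_constraint H1 (A ord0) (B ord0).
exists H2 => [|phi phiH2 i].
  apply: leq_trans dH1 _; rewrite big_ord_recl addnA leq_add2r.
  exact: dH2.
have [i0 ->|->] := unliftP ord0 i; last exact: H2P.
exact: (H1P phi (subvP H21 _ phiH2) i0).
Qed.

End HomSpaces.

Section GeneratorHoms.
Variables (F : fieldType) (V : vectType F) (k n : nat).
Local Notation d := (\dim (fullv : {vspace V})).
Local Notation Lk := (k.-tupleprod ({vspace V} : latticeType vspace_display))%type.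
Variable x : 'I_n -> Lk.
Hypothesis genx : lattice_generates (range x).

(** The image under phi commutes with sums and sends an intersection into the intersection of the
    images, so the condition defines a sublattice. *)
Lemma generators_hom (i j : 'I_k) (phi : 'End(V)) :
  (forall s, (phi @: tnth (x s) i <= tnth (x s) j)%VS) ->
  forall u : Lk, (phi @: tnth u i <= tnth u j)%VS.
Proof.
move=> phix u.
suff E : [set u : Lk | (phi @: tnth u i <= tnth u j)%VS] = setT.
  by have : [set u : Lk | (phi @: tnth u i <= tnth u j)%VS] u by rewrite E.
apply: genx => [s t /= ss st|_ [s _ <-]]; last exact: phix.
rewrite !tnth_joinv !tnth_meetv limgD; split; first exact: addvS.
by apply: subv_trans (limg_cap _ _ _) _; apply: capvS.
Qed.

Lemma generators_hom0 (i j : 'I_k) (phi : 'End(V)) : i != j ->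
  (forall s, (phi @: tnth (x s) i <= tnth (x s) j)%VS) -> phi = 0.
Proof.
move=> ij /generators_hom/(_ [tuple (if l == i then fullv else 0)%VS | l < k]).
rewrite !tnth_mktuple eqxx eq_sym (negbTE ij) subv0 => /eqP phi0.
apply/lfunP => v; rewrite lfunE /=; apply/eqP.
by rewrite -memv0 -phi0 memv_img ?memvf.
Qed.

(** Applied to constant tuples, [generators_hom] shows that phi preserves every line; comparing
    basis vectors with their sums makes the eigenvalues equal. *)
Lemma generators_endo (i : 'I_k) (phi : 'End(V)) :
  (forall s, (phi @: tnth (x s) i <= tnth (x s) i)%VS) -> phi \in <[\1%VF]>%VS.
Proof.
move=> /generators_hom phiL.
have scal v : exists a, phi v = a *: v.
  apply/vlineP; have := phiL [tuple <[v]>%VS | _ < k]; rewrite tnth_mktuple.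
  by move=> /subvP; apply; apply/memv_img/memv_line.
have [a0 Ea0] := scal (basv 0); apply/vlineP; exists a0.
have Ebas j : (j < d)%N -> phi (basv j) = a0 *: basv j.
  move=> jd; have [->//|j0] := eqVneq j 0%N.
  have d0 : (0 < d)%N by apply: leq_trans jd.
  have [b Eb] := scal (basv j); have [c] := scal (basv 0 + basv j).
  rewrite linearD /= Ea0 Eb scalerDr => E.
  have := congr1 (coordv j) E; have := congr1 (coordv 0) E.
  rewrite !(linearD, linearZ) /= !coordv_bas // !eqxx (negbTE j0) eq_sym (negbTE j0).
  by rewrite !mulr0 !mulr1 !addr0 !add0r => -> ->.
apply/lfunP => v; rewrite lfunE /= lfunE /=.
have -> : v = vec (fun j => coordv j v).
  by apply: coordv_inj => j; rewrite coordv_vec; case: ltnP => // /coordv_out->.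
rewrite /vec linear_sum scaler_sumr; apply: eq_bigr => j _.
by rewrite linearZ /= Ebas // !scalerA mulrC.
Qed.

Hypothesis d3 : d = 3%N.

Let cost (a b : nat) := (a * (3 - b))%N.

(** Fewer than 8 equations on the 9-dimensional End(V) would leave a solution that is not a
    homothety. *)
Lemma generators_endo_cost (i : 'I_k) :
  (8 <= \sum_(s < n) cost (\dim (tnth (x s) i)) (\dim (tnth (x s) i)))%N.
Proof.
have [H dH HP] := hom_constraints (fun s => tnth (x s) i) (fun s => tnth (x s) i).
have : (\dim H <= 1)%N.
  suff /dimvS/leq_trans : (H <= <[\1%VF]>)%VS by apply; rewrite dim_vline leq_b1.
  by apply/subvP => phi /HP; apply: generators_endo.
by move: dH; rewrite d3 /cost; lia.
Qed.

Lemma generators_hom_cost (i j : 'I_k) : i != j ->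
  (9 <= \sum_(s < n) cost (\dim (tnth (x s) i)) (\dim (tnth (x s) j)))%N.
Proof.
move=> ij.
have [H dH HP] := hom_constraints (fun s => tnth (x s) i) (fun s => tnth (x s) j).
have : (\dim H <= 0)%N.
  rewrite leqn0 dimv_eq0 -subv0; apply/subvP => phi /HP/(generators_hom0 ij) ->.
  exact: mem0v.
by move: dH; rewrite d3 /cost; lia.
Qed.

End GeneratorHoms.

(** * Four generators in dimension 3: necessary conditions *)

Section GeneratorCount.
Variables (F : fieldType) (V : vectType F) (k : nat).
Local Notation d := (\dim (fullv : {vspace V})).
Local Notation Lk := (k.-tupleprod ({vspace V} : latticeType vspace_display))%type.
Hypothesis d3 : d = 3%N.

Let dim3 (U : {vspace V}) : (\dim U <= 3)%N.
Proof. by rewrite -d3 dimvS ?subvf. Qed.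

Let endo_cost (U : {vspace V}) :
  (\dim U * (3 - \dim U) = 2 * ((\dim U == 1) + (\dim U == 2)))%N.
Proof. by have := dim3 U; case: (\dim U) => [|[|[|[|]]]]. Qed.

(** A point or a plane costs 2 equations and any other component costs none, while at least 8 are
    required. *)
Lemma generators_ge4 n (x : 'I_n -> Lk) : (0 < k)%N ->
  lattice_generates (range x) -> (4 <= n)%N.
Proof.
move=> k0 genx; have := generators_endo_cost genx d3 (Ordinal k0).
under eq_bigr do rewrite endo_cost; rewrite -big_distrr /=.
set c := (\sum_(i < n) _)%N; suff : (c <= n)%N by lia.
rewrite -[leqRHS]card_ord -sum1_card; apply: leq_sum => i _.
by case: (\dim _) => [|[|[|]]].
Qed.

Section FourGenerators.
Variable x : 'I_4 -> Lk.
Hypothesis genx : lattice_generates (range x).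

(** With four generators the count is tight, so every component is a point or a plane. *)
Let dim12 i s : \dim (tnth (x s) i) = (\dim (tnth (x s) i) == 2%N).+1.
Proof.
have := generators_endo_cost genx d3 i.
under eq_bigr do rewrite endo_cost; rewrite -big_distrr /= (bigD1 s) //=.
set c := (\sum_(j < 4 | j != s) _)%N; have : (c <= 3)%N.
  have <- : (\sum_(j < 4 | j != s) 1 = 3)%N by rewrite sum1_card cardC1 card_ord.
  by apply: leq_sum => j _; case: (\dim _) => [|[|[|]]].
by move: (dim3 (tnth (x s) i)); case: (\dim (tnth (x s) i)) => [|[|[|m]]] /=; lia.
Qed.

Let planes i := finset (fun s => \dim (tnth (x s) i) == 2%N).

(** Equal types cost 2, plane into point 4, point into plane 1. *)
Let hom_cost i j : (\sum_(s < 4) \dim (tnth (x s) i) * (3 - \dim (tnth (x s) j)) =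
  8 + 2 * #|planes i :\: planes j| - #|planes j :\: planes i|)%N.
Proof.
suff <- : (\sum_(s < 4) \dim (tnth (x s) i) * (3 - \dim (tnth (x s) j)) +
    #|planes j :\: planes i| = 8 + 2 * #|planes i :\: planes j|)%N by rewrite addnK.
have cardE (A : {set 'I_4}) : (#|A| = \sum_(s < 4) (s \in A))%N.
  by rewrite -sum1_card big_mkcond; apply: eq_bigr => s _; case: (s \in A).
have -> : (8 = \sum_(s < 4) 2)%N by rewrite sum_nat_const card_ord.
rewrite !cardE big_distrr -!big_split; apply: eq_bigr => s _ /=; rewrite !inE.
move: (dim12 i s) (dim12 j s).
by case: (\dim _) => [|[|[|?]]] // _; case: (\dim _) => [|[|[|?]]].
Qed.

Let planes_inj : injective planes.
Proof.
move=> i j E; apply/eqP/negP => /negP ij.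
have := generators_hom_cost genx d3 ij; rewrite hom_cost E finset.setDv cards0 //.
Qed.

(** Let a and b be the sizes of the two differences. The cost bound in both directions gives 2a > b
    and 2b > a; unequal solutions have a + b >= 5, but only four generators exist. *)
Let card_planes i j : #|planes i| = #|planes j|.
Proof.
have [->//|ij] := eqVneq i j.
have := generators_hom_cost genx d3 ij; rewrite hom_cost.
have ji : j != i by rewrite eq_sym.
have := generators_hom_cost genx d3 ji; rewrite hom_cost.
have := cardsID (planes i) (planes j); have := cardsID (planes j) (planes i).
rewrite [planes j :&: _]finset.setIC.
have : (#|planes i :\: planes j| + #|planes j :\: planes i| <= 4)%N.
  rewrite -[leqRHS](card_ord 4) -cardsUI.
  rewrite (_ : _ :&: _ = finset.set0) ?cards0 ?addn0 ?max_card //.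
  by apply/setP => s; rewrite !inE; case: eqP; rewrite ?andbF.
lia.
Qed.

(** With two planes and two points, v -> f(v) w has rank one and preserves all four, where f is a
    nonzero form vanishing on both points and w a nonzero vector of both planes; it is not a
    homothety. *)
Let planes_neq2 i : #|planes i| != 2%N.
Proof.
apply/negP => P2; have /cards2P[a [b [ab Pab]]] := P2.
have : #|~: planes i| == 2%N by rewrite cardsCs finset.setCK card_ord (eqP P2).
move=> /cards2P[c [e [ce Pce]]].
have Pdim s : (\dim (tnth (x s) i) == 2%N) = (s \in [set a; b]%SET) by rewrite -Pab inE.
have Cdim s : (\dim (tnth (x s) i) != 2%N) = (s \in [set c; e]%SET).
  by rewrite -Pce !inE.
set U := fun s => tnth (x s) i.
have dUa : \dim (U a) = 2%N by apply/eqP; rewrite Pdim !inE eqxx.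
have dUb : \dim (U b) = 2%N by apply/eqP; rewrite Pdim !inE eqxx orbT.
have dUc : \dim (U c) = 1%N.
  by rewrite /U dim12 -[_ == _]negbK Cdim !inE eqxx.
have dUe : \dim (U e) = 1%N.
  by rewrite /U dim12 -[_ == _]negbK Cdim !inE eqxx orbT.
have [f Hf f0] : exists2 f : 'Hom(V, F^o), (f @: (U c + U e) <= 0)%VS & f != 0.
  have [H _ [dH HP]] :=
    hom_constraint (fullv : {vspace 'Hom(V, F^o)}) (U c + U e)%VS 0%VS.
  exists (vpick H); first exact/HP/memv_pick.
  rewrite vpick0 -dimv_eq0 -lt0n; move: dH; rewrite dimv0 subn0.
  have -> : \dim (fullv : {vspace F^o}) = 1%N by rewrite dimvf.
  have -> : \dim (fullv : {vspace 'Hom(V, F^o)}) = 3%N.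
    by rewrite dimvf -[dim _]/(dim V * 1)%N -dimvf d3.
  have := dimv_sum_cap (U c) (U e); rewrite dUc dUe muln1 => E.
  by case: (\dim H) => // ; move: E; rewrite add0n; lia.
have [u fu] : exists u, f u != 0.
  apply: contrapT => f_0; case/eqP: f0; apply/lfunP => u; rewrite lfunE /=.
  by have [//|fu] := eqVneq (f u) 0; case: f_0; exists u.
have [w w0 /memv_capP[wa wb]] : exists2 w, w != 0 & w \in (U a :&: U b)%VS.
  exists (vpick (U a :&: U b)%VS); last exact: memv_pick.
  rewrite vpick0 -dimv_eq0 -lt0n; have := dimv_sum_cap (U a) (U b).
  by have := dim3 (U a + U b); rewrite dUa dUb; lia.
pose g v := (f v : F) *: w.
have g_lin : linear g by move=> r v1 v2; rewrite /g linearP scalerDl -scalerA.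
pose gL : {linear V -> V} := HB.pack g (GRing.isLinear.Build F V V *:%R g g_lin).
have gU s : (linfun gL @: U s <= U s)%VS.
  apply/subvP => _ /memv_imgP[v vU ->]; rewrite lfunE /= /g.
  have [] := boolP (\dim (U s) == 2%N).
    by rewrite Pdim !inE => /orP[]/eqP->; rewrite memvZ.
  rewrite Cdim !inE => sce; suff -> : f v = 0 by rewrite scale0r mem0v.
  apply/eqP; rewrite -memv0; apply: (subvP Hf); apply: memv_img.
  by case/orP: sce vU => /eqP->; apply/subvP; rewrite (addvSl, addvSr).
have /vlineP[r Er] := generators_endo genx gU.
have Eg v : g v = r *: v.
  by have := congr1 (fun h : 'End(V) => h v) Er; rewrite !lfunE /= lfunE.
have r0 : r = 0.
  have := Eg (vpick (U c)); rewrite /g (_ : f _ = 0) ?scale0r.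
    move/esym/eqP; rewrite scaler_eq0 vpick0 -dimv_eq0 dUc orbF.
    by move/eqP.
  apply/eqP; rewrite -memv0; apply: (subvP Hf); apply/memv_img/(subvP (addvSl _ _)).
  exact: memv_pick.
have := Eg u; rewrite r0 scale0r /g => /eqP.
by rewrite scaler_eq0 (negbTE fu) (negbTE w0).
Qed.

(** The sets [planes i] are distinct c-subsets of a 4-set with c != 2, and 'C(4, c) <= 4 for such
    c. *)
Lemma four_generators_le4 : (k <= 4)%N.
Proof.
have [k_0|k0] := posnP k; first by rewrite k_0.
pose i0 := Ordinal k0.
rewrite -[k]card_ord -(card_imset _ planes_inj).
pose c := #|planes i0|; apply: leq_trans (_ : 'C(4, c) <= 4)%N.
  rewrite -[X in 'C(X, _)](card_ord 4) -card_draws; apply/subset_leq_card/fintype.subsetP.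
  by move=> _ /imsetP[i _ ->]; rewrite inE (card_planes i i0).
have : (c <= 4)%N by rewrite -[leqRHS](card_ord 4) max_card.
by have := planes_neq2 i0; rewrite -/c; case: c => [|[|[|[|[|]]]]].
Qed.

End FourGenerators.
End GeneratorCount.

(** * Four generators in dimension 3 *)

(* At z = (plane, point, point, point) this is V; if z_0 is a point and z is  *)
(* a cyclic shift of the former, it is 0.                                     *)
Definition isolate disp (L : latticeType disp) (z0 z1 z2 z3 : L) : L :=
  Order.join (Order.join
    (Order.meet (Order.meet z1 (Order.join z0 z2)) (Order.join z0 z3))
    (Order.meet (Order.meet z2 (Order.join z0 z1)) (Order.join z0 z3)))
    (Order.meet (Order.meet z3 (Order.join z0 z1)) (Order.join z0 z2)).

Lemma sublattice_isolate disp (L : latticeType disp) (S : set L) (z0 z1 z2 z3 : L) :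
  sublattice S -> S z0 -> S z1 -> S z2 -> S z3 -> S (isolate z0 z1 z2 z3).
Proof.
move=> Slat S0 S1 S2 S3.
have SJ s t : S s -> S t -> S (Order.join s t) by move=> Ss St; case: (Slat s t).
have SM s t : S s -> S t -> S (Order.meet s t) by move=> Ss St; case: (Slat s t).
by rewrite /isolate; do !(exact: (SJ _ _) || apply: (SJ _ _) || apply: (SM _ _)).
Qed.

Section Plane.
Variables (F : fieldType) (V : vectType F).
Local Notation d := (\dim (fullv : {vspace V})).
Hypothesis d3 : d = 3%N.
Implicit Types (v : V).

Definition quad (n : nat) : {vspace V} :=
  nth (chainsp true) [:: coordsp (fun j => odd j == false);
    coordsp (fun j => odd j == true); chainsp false] n.

(** The forms l1, l2, l3 are coordinates along the points [quad 1], [quad 2], [quad 3]; in them the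
    plane [quad 0] is l1 = l2 + l3. *)
Let l1 v := coordv 0 v + coordv 1 v + coordv 2 v.
Let l2 v := coordv 0 v.
Let l3 v := coordv 2 v.

Let coord3 v : coordv 3 v = 0. Proof. by rewrite coordv_out ?d3. Qed.

Let eq3 u v : (forall i, (i < 3)%N -> coordv i u = coordv i v) -> u = v.
Proof.
by move=> E; apply: coordv_inj => i; have [/E//|i3] := ltnP i 3; rewrite !coordv_out ?d3.
Qed.

Let l_eq0 v : l1 v = 0 -> l2 v = 0 -> l3 v = 0 -> v = 0.
Proof.
rewrite /l1 /l2 /l3 => E1 E0 E2; apply: eq3 => -[|[|[|]]] // _; rewrite linear0 //.
by rewrite E0 E2 add0r addr0 in E1.
Qed.

Let quad0P v : v \in quad 0 <-> coordv 1 v = 0.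
Proof.
rewrite mem_coordsp; split=> [|v1 i]; first exact.
have [i3|i3] := ltnP i 3; last by rewrite coordv_out ?d3.
by case: i i3 => [|[|[|]]].
Qed.

Let quad1P v : v \in quad 1 <-> l2 v = 0 /\ l3 v = 0.
Proof.
rewrite mem_coordsp; split=> [H|[v0 v2] i]; first by split; apply: H.
have [i3|i3] := ltnP i 3; last by rewrite coordv_out ?d3.
by case: i i3 => [|[|[|]]].
Qed.

Let quad2P v : v \in quad 2 <-> l1 v = 0 /\ l3 v = 0.
Proof.
rewrite chainspP /l1 /l3; split=> [[H _]|[v1 v2]].
  have := H 0%N erefl; have := H 2%N erefl.
  by rewrite coord3 !addr0 => -> ->; rewrite addr0.
split=> // -[|[|[|i]]] //= _; first by rewrite -v1 v2 addr0.
  by rewrite v2 coord3 addr0.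
by rewrite !coordv_out ?addr0 ?d3.
Qed.

Let quad3P v : v \in quad 3 <-> l1 v = 0 /\ l2 v = 0.
Proof.
rewrite chainspP /l1 /l2; split=> [[H /(_ isT) v0]|[v1 v0]].
  by have := H 1%N erefl; rewrite v0 add0r.
split=> // -[|[|[|i]]] //= _; first by rewrite -v1 v0 add0r.
by rewrite !coordv_out ?addr0 ?d3.
Qed.

Let l1D u v : l1 (u + v) = l1 u + l1 v.
Proof. by rewrite /l1 !linearD /=; ring. Qed.

Let l2D u v : l2 (u + v) = l2 u + l2 v. Proof. exact: linearD. Qed.
Let l3D u v : l3 (u + v) = l3 u + l3 v. Proof. exact: linearD. Qed.

Let sum12 v : v \in (quad 1 + quad 2)%VS -> l3 v = 0.
Proof.
by move=> /memv_addP[u /quad1P[_ u0] [w /quad2P[_ w0] ->]]; rewrite l3D u0 w0 addr0.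
Qed.

Let sum13 v : v \in (quad 1 + quad 3)%VS -> l2 v = 0.
Proof.
by move=> /memv_addP[u /quad1P[u0 _] [w /quad3P[_ w0] ->]]; rewrite l2D u0 w0 addr0.
Qed.

Let sum23 v : v \in (quad 2 + quad 3)%VS -> l1 v = 0.
Proof.
by move=> /memv_addP[u /quad2P[u0 _] [w /quad3P[w0 _] ->]]; rewrite l1D u0 w0 addr0.
Qed.

Let l123 v : coordv 1 v = l1 v - l2 v - l3 v.
Proof. by rewrite /l1 /l2 /l3; ring. Qed.

Let vec3 (a b c : F) : V := vec (nth 0 [:: a; b; c]).

Let coord_vec3 a b c i : coordv i (vec3 a b c) = nth 0 [:: a; b; c] i.
Proof.
rewrite coordv_vec; case: ltnP => // i3; rewrite nth_default //=.
by rewrite -d3.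
Qed.

Let addv_quad0 n : (quad 0 + quad n.+1)%VS = fullv :> {vspace V}.
Proof.
apply/eqP; rewrite eqEsubv subvf; apply/subvP => v _.
suff [w wn w1] : exists2 w, w \in quad n.+1 & coordv 1 w = coordv 1 v.
  rewrite -[v](subrK w) memv_add //; apply/quad0P.
  by rewrite linearB /= w1 subrr.
case: n => [|[|n]].
- by exists (vec3 0 (coordv 1 v) 0); [apply/quad1P|]; rewrite /l2 /l3 !coord_vec3.
- exists (vec3 (- coordv 1 v) (coordv 1 v) 0); last by rewrite coord_vec3.
  apply/quad2P; rewrite /l1 /l3 !coord_vec3 /=.
  by rewrite addNr addr0.
have -> : quad n.+3 = quad 3 by rewrite /quad /= nth_nil.
exists (vec3 0 (coordv 1 v) (- coordv 1 v)); last by rewrite coord_vec3.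
by apply/quad3P; rewrite /l1 /l2 !coord_vec3 /= add0r addrN.
Qed.

Let addv_quad123 : (quad 1 + quad 2 + quad 3)%VS = fullv :> {vspace V}.
Proof.
apply/eqP; rewrite eqEsubv subvf; apply/subvP => v _.
have -> : v = vec3 0 (l1 v) 0 + vec3 (l2 v) (- l2 v) 0 + vec3 0 (- l3 v) (l3 v).
  apply: eq3 => i; rewrite !linearD /= !coord_vec3.
  by case: i => [|[|[|]]] //= _; rewrite /l1 /l2 /l3; ring.
rewrite !memv_add //; first by apply/quad1P; rewrite /l2 /l3 !coord_vec3.
  by apply/quad2P; rewrite /l1 /l3 !coord_vec3 /=; split=> //; ring.
by apply/quad3P; rewrite /l1 /l2 !coord_vec3 /=; split=> //; ring.
Qed.

Let cap3_eq0 (A B C : {vspace V}) :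
  (forall v, v \in A -> v \in B -> v \in C -> v = 0) -> (A :&: B :&: C = 0)%VS.
Proof.
move=> H; apply/eqP; rewrite -subv0; apply/subvP => v.
by move=> /memv_capP[/memv_capP[vA vB] vC]; rewrite memv0; apply/eqP/H.
Qed.

Let quad0_dep v : v \in quad 0 -> l1 v = l2 v + l3 v.
Proof. by move=> /quad0P /eqP; rewrite l123 -addrA -opprD subr_eq0 => /eqP. Qed.
Let dep1 v : v \in quad 1 -> l1 v = 0 -> v = 0.
Proof. by move=> /quad1P[? ?] ?; apply: l_eq0. Qed.
Let dep2 v : v \in quad 2 -> l2 v = 0 -> v = 0.
Proof. by move=> /quad2P[? ?] ?; apply: l_eq0. Qed.
Let dep3 v : v \in quad 3 -> l3 v = 0 -> v = 0.
Proof. by move=> /quad3P[? ?] ?; apply: l_eq0. Qed.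

Lemma isolate_quad n : isolate (quad (n %% 4)) (quad (n.+1 %% 4)) (quad (n.+2 %% 4))
  (quad (n.+3 %% 4)) = (if (n %% 4 == 0)%N then fullv else 0)%VS :> {vspace V}.
Proof.
rewrite -[n.+3]addn3 -[n.+2]addn2 -[n.+1]addn1 -!(modnDml n).
have : (n %% 4 < 4)%N by rewrite ltn_mod.
case: (n %% 4)%N => [|[|[|[|//]]]] _; rewrite /isolate !vspace_joinE !vspace_meetE /=.
- by rewrite !addv_quad0 !capvf; exact: addv_quad123.
- rewrite !cap3_eq0 ?addv0 // => v.
  + move=> /quad0_dep E /sum12 E3 /sum13 E2; apply: l_eq0 => //.
    by rewrite E E2 E3 addr0.
  + by move=> v3 /sum12 E _; apply: dep3.
  by move=> v2 /sum13 E _; apply: dep2.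
- rewrite ![(quad 2 + quad 1)%VS]addvC !cap3_eq0 ?addv0 // => v.
  + by move=> v1 /sum23 E _; apply: dep1.
  + move=> /quad0_dep E /sum23 E1 /sum12 E3; apply: l_eq0 => //.
    by move: E; rewrite E1 E3 addr0 => <-.
  by move=> v3 _ /sum12 E; apply: dep3.
rewrite ![(quad 3 + quad 2)%VS]addvC ![(quad 3 + quad 1)%VS]addvC.
rewrite !cap3_eq0 ?addv0 // => v.
- by move=> v2 _ /sum13 E; apply: dep2.
- by move=> v1 _ /sum23 E; apply: dep1.
move=> /quad0_dep E /sum13 E2 /sum23 E1; apply: l_eq0 => //.
by move: E; rewrite E1 E2 add0r => <-.
Qed.

(** Over a prime field no graphs are needed, hence the empty family of matrices. *)
Lemma quad_full (S : set {vspace V}) : @field_generates F set0 ->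
  (forall U W, S U -> S W -> S (U + W)%VS /\ S (U :&: W)%VS) ->
  (forall n, (n < 4)%N -> S (quad n)) -> S = setT.
Proof.
move=> F0 Slat Squad.
apply: (@quadruple_graphs_full F V S Slat _ _ _ Empty_set 0 (fun=> fun _ _ => 0)).
- by case; [apply: (Squad 1%N)|apply: (Squad 0%N)].
- by case; [apply: (Squad 3%N)|apply: (Squad 2%N)].
- by rewrite d3.
- by case.
by apply: field_generatesW F0 => x [].
Qed.

Variable k : nat.
Local Notation Lk := (k.-tupleprod ({vspace V} : latticeType vspace_display))%type.

(** Coordinate i sees the quadruple shifted cyclically by i, so the i-th generator has its plane
    exactly there; the summand 4 keeps the subtraction from truncating. *)
Lemma four_generators : @field_generates F set0 -> (0 < k <= 4)%N ->
  lattice_generates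
    (range (fun s : 'I_4 => [tuple quad ((s + 4 - i) %% 4) | i < k] : Lk)).
Proof.
move=> F0 /andP[k0 k4] S Slat genS.
pose x (n : nat) : Lk := [tuple quad ((n + 4 - i) %% 4) | i < k].
have Sx n : S (x (n %% 4)%N).
  by apply: genS; exists (inord (n %% 4)); rewrite ?inordK // ltn_mod.
have xE n (i : 'I_k) : tnth (x (n %% 4)%N) i = quad ((n + (4 - i)) %% 4).
  by rewrite tnth_mktuple -addnBA ?modnDml // ltnW // (leq_trans (ltn_ord i)).
apply: sublattice_power_full => // i.
  suff E : [set U | exists2 s : Lk, S s & tnth s i = U] = setT.
    by move=> U; have : [set U | exists2 s : Lk, S s & tnth s i = U] U by rewrite E.
  apply: quad_full => // [U1 U2 [s1 S1 <-] [s2 S2 <-]|n n4].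
    split; [exists (Order.join s1 s2)|exists (Order.meet s1 s2)];
      rewrite ?tnth_joinv ?tnth_meetv //; by have [] := Slat _ _ S1 S2.
  exists (x ((n + i) %% 4)%N) => //; rewrite xE -addnA subnKC.
    by rewrite modnDr modn_small.
  by rewrite ltnW // (leq_trans (ltn_ord i)).
(* At coordinate j the first argument is a plane only if j = i, so [isolate_quad] gives V at i and 0
   elsewhere. *)
exists (isolate (x (i %% 4)%N) (x (i.+1 %% 4)%N) (x (i.+2 %% 4)%N) (x (i.+3 %% 4)%N)).
  exact: sublattice_isolate.
have isoE j : tnth (isolate (x (i %% 4)%N) (x (i.+1 %% 4)%N) (x (i.+2 %% 4)%N)
    (x (i.+3 %% 4)%N)) j = (if ((i + (4 - j)) %% 4 == 0)%N then fullv else 0)%VS.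
  rewrite -isolate_quad -!addSn -!xE /isolate.
  by rewrite !(tnth_joinv, tnth_meetv).
have ik := leq_trans (ltn_ord i) k4.
split=> [|j ji]; rewrite isoE; first by rewrite subnKC ?modnn // ltnW.
have jk := leq_trans (ltn_ord j) k4; have {}ji : (j : nat) != i by [].
by case: eqP => //; lia.
Qed.

End Plane.

(** * Passage to cardinals, and the four claims *)

Lemma ord_card_le (M : Type) (m : nat) :
  (forall n, (M =c 'I_n)%type -> (m <= n)%N) -> ('I_m <=c M)%type.
Proof.
move=> Mm; have [//|Mle] := card_le_total 'I_m M.
have [n Mn] : finite_set [set: M].
  by apply: card_le_finite Mle _; exists m; apply/card_esym/card_II.
have {}Mn : (M =c 'I_n)%type := card_eq_trans Mn card_II.
apply: card_le_trans (card_eqc_le (card_eqc_sym Mn)).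
apply/card_le_injP; exists (widen_ord (Mm n Mn)) => i j /(congr1 val) /= E.
exact: val_inj.
Qed.

Lemma square_div4 (d : nat) : (d ^ 2 %/ 4 = d %/ 2 * (d - d %/ 2))%N.
Proof.
have := divn_eq d 2; have : (d %% 2 < 2)%N by rewrite ltn_mod.
set r := (d %/ 2)%N; case: (d %% 2)%N => [|[|//]] _ ->.
  by rewrite (_ : (_ ^ 2 = r * r * 4)%N) ?mulnK //; lia.
rewrite (_ : (_ ^ 2 = r * r.+1 * 4 + 1)%N); last by lia.
by rewrite divnMDl // addn0; lia.
Qed.

Lemma mul_sub_le_square_div4 (d r : nat) : (r <= d)%N -> (r * (d - r) <= d ^ 2 %/ 4)%N.
Proof.
move=> rd; rewrite leq_divRL // mulnC -{2}(subnKC rd).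
exact: (nat_AGM2 r (d - r)).
Qed.

Lemma mng_field0_generates (F : fieldType) :
  (mng_field F =c 'I_0)%type -> @field_generates F set0.
Proof.
move=> t0; have [[X genX /card_eq_range[g _ gX]] _] := mng_fieldP F.
have [f _] := (card_le_injP _ _).1 (card_eqc_le t0).
by apply: field_generatesW genX; rewrite -gX => x [s _ _]; case: (f s).
Qed.

Lemma mng_lattice_range disp (L : latticeType disp) (n : nat) :
  (mng_lattice L =c 'I_n)%type ->
  exists x : 'I_n -> L, lattice_generates (range x).
Proof.
move=> Ln; have [[X genX X_eq] _] := mng_latticeP L.
have /card_eq_range[x _ xX] := card_eq_trans (card_eqc_sym Ln) X_eq.
by exists x; rewrite xX.
Qed.

Local Close Scope ring_scope.
Local Close Scope classical_set_scope.

Theorem theorem3p2 (F : fieldType) (d : nat) (V : vectType F) (k : nat) :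
  (3 <= d)%N -> \dim (fullv : {vspace V}) = d -> (0 < k)%N ->
  let t := mng_field F in
  let mu := cgauss_binomial d (d %/ 2) F in
  let L : latticeType vspace_display := {vspace V} in
  let Lk : latticeType _ := (k.-tupleprod L)%type in
  [/\ (cceil_div t (d ^ 2 %/ 4) <=c mng_lattice L)%type /\
      (mng_lattice L <=c mng_lattice Lk)%type,
      ('I_k <=c mu)%type ->
        (mng_lattice Lk <=c 'I_5 + cceil_div t (d ^ 2 %/ 4))%type,
      (t =c 'I_0)%type -> d = 3 -> k \in [:: 1; 2; 3; 4]%N ->
        (mng_lattice Lk =c 'I_4)%type
    & (t =c 'I_0)%type -> d = 3 -> (5 <= k)%N -> ('I_k <=c mu)%type ->
        (mng_lattice Lk =c 'I_5)%type].
Proof.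
move=> d3 dV k0 t mu L Lk.
have n0 : (0 < d ^ 2 %/ 4)%N.
  by rewrite square_div4 muln_gt0 divn_gt0 // subn_gt0 ltn_Pdiv; lia.
have [tle tmin] := cceil_divP t n0.
have upper : ('I_k <=c mu)%type ->
    (mng_lattice Lk <=c 'I_5 + cceil_div t (d ^ 2 %/ 4))%type.
  rewrite /mu -dV => /subspace_antichain_ex[|W Winc]; first by rewrite dV ltnW.
  apply: (@power_upper_bound F V k _ W (d %/ 2)); rewrite ?dV // ?ltn_Pdiv //.
    by lia.
  by rewrite -square_div4.
split=> // [|t0 d_3 k14|t0 d_3 k5 kmu].
- split; last exact: mng_lattice_power_ge.
  apply: tmin; apply: mng_field_le_mul; rewrite dV; first exact: ltnW.
  by move=> r; apply: mul_sub_le_square_div4.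
- rewrite d_3 in dV; apply: card_le_anti; last first.
    apply: ord_card_le => n /mng_lattice_range[x genx].
    exact: (generators_ge4 dV k0 genx).
  have k4 : (0 < k <= 4)%N by rewrite k0; move: k14; rewrite !inE; lia.
  have gen4 := four_generators dV (mng_field0_generates t0) k4.
  exact: (card_le_trans ((mng_latticeP Lk).2 _ gen4) (card_range_le _)).
rewrite d_3 in dV; apply: card_le_anti; last first.
  apply: ord_card_le => n /mng_lattice_range[x genx].
  have := generators_ge4 dV k0 genx; rewrite leq_eqVlt => /orP[/eqP n4|//].
  move: x genx; rewrite -n4 => x genx.
  by have := four_generators_le4 dV genx; rewrite leqNgt k5.
apply: card_le_trans (upper kmu) _.
(* For t = 0 the ceiling is empty, so the bound of (ii) reduces to 5. *)
have /tmin/card_le_injP[f _] : (t <=c Empty_set * 'I_(d ^ 2 %/ 4))%type.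
  have [e _] := (card_le_injP _ _).1 (card_eqc_le t0).
  apply/card_le_injP; exists (fun s => False_rect _ (notF (ltn_ord (e s)))) => s.
  by case: (e s).
apply/card_le_injP.
exists (fun x => match x with inl i => i | inr c => match f c with end end).
case=> [i|c]; last by case: (f c).
by case=> [j /= ->|c'] //; case: (f c').
Qed.
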